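(* Let $K^{\mathbf N}_{Church}$, $K^{\mathbf Z}_{Church}$, $K^{\mathbf N}_{card}$, $K^{\mathbf Z}_{card}$, $K_{ord}$ be the Kolmogorov complexities associated (as described in the context) to the effective Church, $\mathbf Z$-Church, cardinal, $\mathbf Z$-cardinal and ordinal representations of integers, and let $K, K^{\infty}, K', {K'}^{\infty}$ be the plain Kolmogorov complexity, the Kolmogorov complexity with possibly infinite computations, and their relativizations to the oracle $\emptyset'$. Then $$K^{\mathbf N}_{Church} =_{\rm ct} K^{\mathbf Z}_{Church}\!\upharpoonright\!\mathbf N =_{\rm ct} K,\qquad K^{\mathbf N}_{card} =_{\rm ct} K^{\infty},\qquad K^{\mathbf Z}_{card}\!\upharpoonright\!\mathbf N =_{\rm ct} K',\qquad K_{ord} =_{\rm ct} {K'}^{\infty},$$ and consequently $$K^{\mathbf N}_{Church} =_{\rm ct} K^{\mathbf Z}_{Church}\!\upharpoonright\!\mathbf N >_{\rm ct} K^{\mathbf N}_{card} >_{\rm ct} K^{\mathbf Z}_{card}\!\upharpoonright\!\mathbf N >_{\rm ct} K_{ord}.$$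
   Context: Comparison up to constants for $f,g:\mathbf N\to\mathbf N$: $f\le_{\rm ct} g$ iff $\exists c\,\forall n\ f(n)\le g(n)+c$; $f=_{\rm ct} g$ iff $f\le_{\rm ct} g$ and $g\le_{\rm ct} f$; $f<_{\rm ct} g$ iff $f\le_{\rm ct} g$ and $\forall c\,\exists n\ f(n)<g(n)-c$; $f>_{\rm ct} g$ means $g<_{\rm ct} f$. $\upharpoonright\mathbf N$ denotes restriction of a function on $\mathbf Z$ to $\mathbf N$. Programs are binary words; complexities below are defined via an optimal universal programming language (all such choices agree up to $=_{\rm ct}$). $K(n)$ is the minimal length of a program which halts and outputs $n$. $K^{\infty}(n)$ is the minimal length of a (possibly non-halting) program which, over its (possibly infinite) run, outputs $n$ in unary (writes exactly $n$ symbols). $K'$ and ${K'}^{\infty}$ are defined in the same way for programs with access to the oracle $\emptyset'$ (a $\Sigma^0_1$-complete set, e.g. the halting problem). Effectivization: $PR(X\to Y)$ is the set of partial recursive functions $X\to Y$ ($X,Y$ type-0 spaces like $\mathbf N,\mathbf N^2$). An effective operation $F:PR(X\to Y)\to PR(Z\to T)$ is one induced by a partial recursive function on Gödel numbers (i.e. there is a partial recursive $f$ on indices with $F(\varphi_e)=\varphi_{f(e)}$); $Eff((X\to Y)\to(Z\to T))$ denotes the set of these. For such a set $\mathcal E$ (or $\mathcal E=PR(X\to Y)$, or a product of such), a partial recursive function (resp. effective operation) $U:\{0,1\}^*\to\mathcal E$ is strongly universal if, with the pairing $\langle e_1\cdots e_n,p\rangle=0e_10e_2\cdots0e_n1p$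 (so $|\langle e,p\rangle|=|p|+2|e|+1$), the family $U_e(p)=U(\langle e,p\rangle)$, $e\in\{0,1\}^*$, enumerates all partial recursive functions (resp. effective operations) $\{0,1\}^*\to\mathcal E$. Given a surjective partial map $\rho:\mathcal E\to\mathbf N$ (or $\to\mathbf Z$) and a strongly universal $U^{\mathcal E}$, $K_\rho(n)=\min\{|p|:\rho(U^{\mathcal E}(p))=n\}$ (independent of $U^{\mathcal E}$ up to $=_{\rm ct}$). Representations: (i) Church: on $\mathcal E=Eff((\mathbf N\to\mathbf N)\to(\mathbf N\to\mathbf N))$ let $It_n(f)=f^{(n)}$ ($n$-fold composite, $f^{(0)}=\mathrm{Id}$); for $n>0$, $It_{-n}(f)$ has domain $\mathrm{Range}(It_n(f))$ and $It_{-n}(f)(x)=y$ where $It_n(f)(y)=x$ and this is the first halting computation found among $It_n(f)(0),It_n(f)(1),\dots$ under dovetailing. $Church^{\mathbf N}(F)=n$ if $F=It_n$ with $n\in\mathbf N$ (else undefined); $Church^{\mathbf Z}(F)=n$ if $F=It_n$ with $n\in\mathbf Z$. (ii) Cardinal: on $PR(\mathbf N\to\mathbf N)$, $card^{\mathbf N}(f)=$ number of elements of $\mathrm{domain}(f)$ if finite, else undefined; on $PR(\mathbf N\to\mathbf N)^2$, $card^{\mathbf Z}(f,g)=card(\mathrm{domain} f)-card(\mathrm{domain} g)$ if both domains are finite, else undefined. (iii) Ordinal: on $PR(\mathbf N^2\to\mathbf N)$, view $\mathrm{domain}(f)\subseteq\mathbf N^2$ as a binary relation, take its transitive closure (a preorder)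 and the associated quotient order; $ord(f)$ is defined iff this quotient order is finite, and then equals its order type (number of elements). $K^{\mathbf N}_{Church},K^{\mathbf Z}_{Church},K^{\mathbf N}_{card},K^{\mathbf Z}_{card},K_{ord}$ are $K_\rho$ for these $\rho$. *)

(* Defs.v *)
From Stdlib Require Import Relation_Operators.
From mathcomp Require Import all_boot all_order all_algebra.
From mathcomp Require Import boolp classical_sets cardinality.

Set Implicit Arguments.
Unset Strict Implicit.
Unset Printing Implicit Defensive.

Local Open Scope classical_set_scope.
Local Open Scope card_scope.

(* The model of computation is the one-variable WHILE language over binary
   trees (N. D. Jones, "Computability and Complexity", 1997), extended with an
   instruction writing one symbol on a unary output tape and an instruction
   querying an oracle. Programs are data, so that the tree of a program serves
   as its Goedel number. *)

Inductive tree : Type := Nil | Cons of tree & tree.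

Definition hd (d : tree) : tree := if d is Cons a _ then a else Nil.
Definition tl (d : tree) : tree := if d is Cons _ b then b else Nil.

Inductive expr : Type :=
  | Var
  | ENil
  | ECons of expr & expr
  | EHd of expr
  | ETl of expr.

Fixpoint eval (e : expr) (d : tree) : tree :=
  match e with
  | Var => d
  | ENil => Nil
  | ECons a b => Cons (eval a d) (eval b d)
  | EHd a => hd (eval a d)
  | ETl a => tl (eval a d)
  end.

Inductive prog : Type :=
  | Assign of expr
  | Seq of prog & prog
  | While of expr & prog
  | Write
  | Ask of expr.

(* Remaining instructions, value of the variable, number of symbols written. *)
Record config : Type := Config
  { todo : seq prog; store : tree; written : nat }.

(* An oracle is a set of trees; [Ask e] conses the answer (true being any
   non-[Nil] tree) onto the variable. A halted configuration is a fixed point. *)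
Definition step (O : pred tree) (s : config) : config :=
  let: Config k d w := s in
  match k with
  | [::] => s
  | Assign e :: k => Config k (eval e d) w
  | Seq a b :: k => Config (a :: b :: k) d w
  | While e a :: k' =>
      if eval e d is Nil then Config k' d w else Config (a :: k) d w
  | Write :: k => Config k d w.+1
  | Ask e :: k =>
      Config k (Cons (if O (eval e d) then Cons Nil Nil else Nil) d) w
  end.

Definition run (O : pred tree) (c : prog) (d : tree) (t : nat) : config :=
  iter t (step O) (Config [:: c] d 0).

Definition halts_in (O : pred tree) (c : prog) (d : tree) (t : nat) : Prop :=
  todo (run O c d t) = [::].

Definition word : Type := seq bool.

Fixpoint code_nat (n : nat) : tree :=
  if n is m.+1 then Cons Nil (code_nat m) else Nil.

Fixpoint code_word (p : word) : tree :=
  if p is b :: q then Cons (if b then Cons Nil Nil else Nil) (code_word q)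
  else Nil.

Fixpoint code_expr (e : expr) : tree :=
  match e with
  | Var => Cons (code_nat 0) Nil
  | ENil => Cons (code_nat 1) Nil
  | ECons a b => Cons (code_nat 2) (Cons (code_expr a) (code_expr b))
  | EHd a => Cons (code_nat 3) (code_expr a)
  | ETl a => Cons (code_nat 4) (code_expr a)
  end.

Fixpoint code_prog (c : prog) : tree :=
  match c with
  | Assign e => Cons (code_nat 0) (code_expr e)
  | Seq a b => Cons (code_nat 1) (Cons (code_prog a) (code_prog b))
  | While e a => Cons (code_nat 2) (Cons (code_expr e) (code_prog a))
  | Write => Cons (code_nat 3) Nil
  | Ask e => Cons (code_nat 4) (code_expr e)
  end.

Lemma code_nat_inj : injective code_nat.
Proof. by elim=> [|m IH] [|n] //= [/IH ->]. Qed.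

Lemma code_word_inj : injective code_word.
Proof. by elim=> [|[] p IH] [|[] q] //= [/IH ->]. Qed.

Lemma code_expr_inj : injective code_expr.
Proof.
elim=> [||a IHa b IHb|a IHa|a IHa] [||a' b'|a'|a'] //=.
- by case=> /IHa -> /IHb ->.
- by move=> [/IHa ->].
- by move=> [/IHa ->].
Qed.

Lemma code_prog_inj : injective code_prog.
Proof.
elim=> [e|a IHa b IHb|e a IHa||e] [e'|a' b'|e' a'||e'] //=.
- by move=> [/code_expr_inj ->].
- by case=> /IHa -> /IHb ->.
- by case=> /code_expr_inj -> /IHa ->.
- by move=> [/code_expr_inj ->].
Qed.

(* Type-0 spaces. *)
Class type0 (X : Type) : Type := Type0
  { code : X -> tree; code_inj : injective code }.

Instance type0_nat : type0 nat := Type0 code_nat_inj.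
Instance type0_word : type0 word := Type0 code_word_inj.
Instance type0_prog : type0 prog := Type0 code_prog_inj.

Lemma code_pair_inj (X Y : Type) (tX : type0 X) (tY : type0 Y) :
  injective (fun z : X * Y => Cons (code z.1) (code z.2)).
Proof.
by move=> [x y] [x' y'] /= [/(@code_inj X tX) -> /(@code_inj Y tY) ->].
Qed.

Instance type0_prod (X Y : Type) (tX : type0 X) (tY : type0 Y) :
  type0 (X * Y) := Type0 (@code_pair_inj X Y tX tY).

(* A partial function is given by its graph. *)
Definition pfun (X Y : Type) : Type := X -> Y -> Prop.

Definition dom (X Y : Type) (f : pfun X Y) : set X := [set x | exists y, f x y].

Definition outputs_in (X Y : Type) {tX : type0 X} {tY : type0 Y}
    (O : pred tree) (c : prog) (x : X) (t : nat) (y : Y) : Prop :=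
  halts_in O c (code x) t /\ store (run O c (code x) t) = code y.

Definition phi_rel (X Y : Type) {tX : type0 X} {tY : type0 Y}
    (O : pred tree) (c : prog) : pfun X Y :=
  fun x y => exists t, outputs_in O c x t y.

Definition no_oracle : pred tree := pred0.

Definition phi (X Y : Type) {tX : type0 X} {tY : type0 Y} (c : prog) :
  pfun X Y := phi_rel no_oracle c.

(* The halting problem. *)
Definition zero_jump : pred tree := fun d =>
  `[< exists c x, d = Cons (code_prog c) x /\
                  exists t, halts_in no_oracle c x t >].

Definition partial_recursive (X Y : Type) {tX : type0 X} {tY : type0 Y}
  (f : pfun X Y) : Prop := exists c, f = phi c.

Definition min_length (A : set word) : nat :=
  xget 0 [set k | (exists2 p, A p & size p = k) /\
                  forall p, A p -> k <= size p].

(* Complexities attached to programming languages. A language is given by an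
   interpreter [u : prog] run on the word p; [sem v p n] says that p, read as a
   program of the language interpreted by v, outputs n. *)
Definition optimal (sem : prog -> word -> nat -> Prop) (u : prog) : Prop :=
  forall v, exists c, forall p n, sem v p n ->
    exists2 q, sem u q n & size q <= size p + c.

Definition complexity (sem : prog -> word -> nat -> Prop) (u : prog) (n : nat) :
  nat := min_length [set p | sem u p n].

Definition halting_sem (O : pred tree) (u : prog) (p : word) (n : nat) : Prop :=
  phi_rel O u p n.

Definition infinite_sem (O : pred tree) (u : prog) (p : word) (n : nat) : Prop :=
  exists t0, forall t, t0 <= t -> written (run O u (code p) t) = n.

(* <e1...en, p> = 0 e1 0 e2 ... 0 en 1 p *)
Definition pair_word (e p : word) : word :=
  flatten [seq [:: false; b] | b <- e] ++ true :: p.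

(* [C] is the set of the admissible maps from words to E. *)
Definition strongly_universal (E : Type) (C : set (word -> E)) (U : word -> E) :
  Prop := C U /\ forall V, C V <-> exists e, V = fun p => U (pair_word e p).

Definition K_rep (E I : Type) (rho : E -> I -> Prop) (U : word -> E) (n : I) :
  nat := min_length [set p | rho (U p) n].

(* Maps from words to PR(X -> Y), to its square, and to Eff, are effective when
   their uncurried forms are. *)
Definition PR_family (X Y : Type) {tX : type0 X} {tY : type0 Y} :
  set (word -> pfun X Y) :=
  [set U | partial_recursive (fun px : word * X => U px.1 px.2)].

Definition PR2_family (X Y : Type) {tX : type0 X} {tY : type0 Y} :
  set (word -> pfun X Y * pfun X Y) :=
  [set U | PR_family (fun p => (U p).1) /\ PR_family (fun p => (U p).2)].

(* An operation is given by its action on programs; it is a map from PR(X -> Y)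
   to PR(Z -> T) when it is extensional. *)
Definition operation (Z T : Type) : Type := prog -> pfun Z T.

Definition extensional (X Y Z T : Type) {tX : type0 X} {tY : type0 Y}
    (F : operation Z T) : Prop :=
  forall e e', phi e = phi e' :> pfun X Y -> F e = F e'.

Definition induced_by_index_map (Z T : Type) {tZ : type0 Z} {tT : type0 T}
    (F : operation Z T) : Prop :=
  exists2 f : pfun prog prog, partial_recursive f &
    forall e, exists2 e', f e e' & F e = phi e'.

(* Effective operations from PR(X -> Y) to PR(Z -> T) if [ext] is true; if
   [ext] is false, extensionality is dropped (see [Church_Z]). *)
Definition effective_operation (ext : bool) (X Y Z T : Type)
    {tX : type0 X} {tY : type0 Y} {tZ : type0 Z} {tT : type0 T}
    (F : operation Z T) : Prop :=
  induced_by_index_map F /\ (ext -> @extensional X Y Z T tX tY F).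

Definition Eff_family (ext : bool) (X Y Z T : Type)
    {tX : type0 X} {tY : type0 Y} {tZ : type0 Z} {tT : type0 T} :
  set (word -> operation Z T) :=
  [set U | @effective_operation ext X Y (word * Z) T _ _ _ _
             (fun e pz => U pz.1 e pz.2)].

Fixpoint iterate (n : nat) (f : pfun nat nat) : pfun nat nat :=
  if n is m.+1 then fun x y => exists2 z, iterate m f x z & f z y
  else fun x y => x = y.

(* [iterate_in n e x t y]: the computation of the n-th iterate of e on x halts
   after t steps with value y. *)
Fixpoint iterate_in (n : nat) (e : prog) (x t y : nat) : Prop :=
  if n is m.+1 then
    exists z t1 t2, [/\ iterate_in m e x t1 z,
      outputs_in no_oracle e z t2 y,
      forall t3, t3 < t2 -> ~ halts_in no_oracle e (code z) t3
      & t = t1 + t2]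
  else t = 0 /\ x = y.

(* Dovetailing: at stage s, t steps of the computation on y are performed, for
   y = 0, ..., s in this order and all t <= s. *)
Definition found_before (y t y' t' : nat) : Prop :=
  maxn y t < maxn y' t' \/ (maxn y t = maxn y' t' /\ y <= y').

Definition inverse_iterate (n : nat) (e : prog) : pfun nat nat :=
  fun x y => exists2 t, iterate_in n e y t x &
    forall y' t', iterate_in n e y' t' x -> found_before y t y' t'.

Definition It (n : int) : operation nat nat := fun e =>
  match n with
  | Posz m => iterate m (phi e)
  | Negz m => inverse_iterate m.+1 e
  end.

Definition Church_N (F : operation nat nat) (n : nat) : Prop := F = It n.

(* For n < 0, [It n] is induced by an index map but depends on the program and
   not only on the function it computes: it is an element of Eff only when
   extensionality is dropped. *)
Definition Church_Z (F : operation nat nat) (n : int) : Prop := F = It n.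

Definition card_N (f : pfun nat nat) (n : nat) : Prop := dom f #= `I_n.

Definition card_Z (fg : pfun nat nat * pfun nat nat) (z : int) : Prop :=
  exists m n, [/\ card_N fg.1 m, card_N fg.2 n & z = (m%:Z - n%:Z)%R].

(* The transitive closure is taken as a preorder on the field of the relation
   (the numbers related to at least one number). *)
Definition field_of (R : nat -> nat -> Prop) : set nat :=
  [set x | exists y, R x y \/ R y x].

Definition preorder_of (R : nat -> nat -> Prop) (x y : nat) : Prop :=
  [/\ field_of R x, field_of R y & x = y \/ clos_trans nat R x y].

Definition quotient_of (R : nat -> nat -> Prop) : set (set nat) :=
  [set [set y | preorder_of R x y /\ preorder_of R y x] | x in field_of R].

Definition ord_rep (f : pfun (nat * nat) nat) (n : nat) : Prop :=
  quotient_of (fun x y => dom f (x, y)) #= `I_n.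

Definition le_ct (f g : nat -> nat) : Prop := exists c, forall n, f n <= g n + c.

Definition eq_ct (f g : nat -> nat) : Prop := le_ct f g /\ le_ct g f.

Definition lt_ct (f g : nat -> nat) : Prop :=
  le_ct f g /\ forall c, exists n, f n < g n - c.

(* Main.v *)
(** Church: the [n]-th iteration operator is built from a program for [n], and
    it maps the successor function and [0] to [n].

    Cardinals: the domain of a recursive function is enumerated by an infinite
    computation, and if a computation writes [n] symbols then the numbers [x]
    such that more than [x] symbols are written form a recursively enumerable
    set of [n] elements. With the halting problem as an oracle, one computes
    exactly the limits of recursive sequences of numbers. The sum of the
    increments of such a sequence minus the sum of its decrements is its limit,
    which yields a difference of two cardinals; conversely, such a difference is
    the limit of its recursive approximations.

    Order types: the halting problem decides whether a number is the least one
    in its class, hence enumerates the classes. Conversely, a symbol written by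
    a computation with oracle corresponds to a true claim that a given step
    writes a symbol and that the approximations agree on it from a given stage
    on. The false claims are recursively enumerable. One takes one node for each
    claim, and merges the nodes of the false claims into a single class.

    Strictness: a program reading a word of length [j] produces a number which
    has no description of length [2 * j] in the weaker sense. *)
Require Import Defs.
From mathcomp Require Import all_boot all_order all_algebra.
From mathcomp Require Import boolp classical_sets cardinality.
From mathcomp Require Import zify.
From Stdlib Require Import Relation_Operators Operators_Properties.
(* MathComp also uses names such as [Nil] and [Cons]. *)
Import Defs.

Set Implicit Arguments.
Unset Strict Implicit.
Unset Printing Implicit Defensive.

Local Open Scope classical_set_scope.
Local Open Scope card_scope.

(** * Codes of the data handled by programs *)

Instance type0_tree : type0 tree := @Type0 tree (fun d => d) (fun d d' e => e).
Instance type0_expr : type0 expr := Type0 code_expr_inj.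

Definition code_bool (b : bool) : tree := if b then Cons Nil Nil else Nil.

Lemma code_bool_inj : injective code_bool.
Proof. by case=> [] []. Qed.

Instance type0_bool : type0 bool := Type0 code_bool_inj.

Section Codes.
Context {X : Type} {tX : type0 X}.

Definition code_option (o : option X) : tree :=
  if o is Some x then Cons Nil (code x) else Nil.

Lemma code_option_inj : injective code_option.
Proof. by case=> [x|] [y|] //= [/(@code_inj X tX) ->]. Qed.

Fixpoint code_seq (s : seq X) : tree :=
  if s is x :: s' then Cons (code x) (code_seq s') else Nil.

Lemma code_seq_inj : injective code_seq.
Proof. by elim=> [|x s IH] [|y s'] //= [/(@code_inj X tX) -> /IH ->]. Qed.

End Codes.

Instance type0_option (X : Type) (tX : type0 X) : type0 (option X) :=
  Type0 (@code_option_inj X tX).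
Instance type0_seq (X : Type) (tX : type0 X) : type0 (seq X) | 100 :=
  Type0 (@code_seq_inj X tX).

Definition code_config (s : config) : tree :=
  Cons (code (todo s)) (Cons (store s) (code (written s))).

Lemma code_config_inj : injective code_config.
Proof.
by case=> k d w [k' d' w'] [/code_seq_inj -> -> /code_nat_inj ->].
Qed.

Instance type0_config : type0 config := Type0 code_config_inj.

(** * Reachability of configurations and computable functions *)

Definition reach (O : pred tree) (s s' : config) : Prop :=
  exists t, iter t (step O) s = s'.

Lemma reach_refl O s : reach O s s.
Proof. by exists 0. Qed.

Lemma reach_trans O s2 s1 s3 : reach O s1 s2 -> reach O s2 s3 -> reach O s1 s3.
Proof. by case=> t <- [t' <-]; exists (t' + t); rewrite iterD. Qed.

Lemma reach_step O s s' : reach O (step O s) s' -> reach O s s'.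
Proof. by case=> t <-; exists t.+1; rewrite iterSr. Qed.

Lemma reach_step1 O s s' : step O s = s' -> reach O s s'.
Proof. by move=> <-; exists 1. Qed.

(** The pending instructions [k] and the count [w] are arbitrary, so that such runs compose inside
    larger programs; the count being the same at both ends, nothing is written. *)
Definition computes (O : pred tree) (c : prog) (d d' : tree) : Prop :=
  forall k w, reach O (Config (c :: k) d w) (Config k d' w).

Definition computable (O : pred tree) {A X : Type} {tA : type0 A}
    {tX : type0 X} (f : A -> X) : Prop :=
  exists c, forall a, computes O c (code a) (code (f a)).

Lemma computes_seq O c1 c2 d1 d2 d3 :
  computes O c1 d1 d2 -> computes O c2 d2 d3 -> computes O (Seq c1 c2) d1 d3.
Proof.
move=> h1 h2 k w; apply: reach_step => /=.
exact: reach_trans (h1 _ _) (h2 _ _).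
Qed.

Lemma computes_assign O e d : computes O (Assign e) d (eval e d).
Proof. by move=> k w; apply: reach_step1. Qed.

Lemma reach_while_stop O e c k d w : eval e d = Nil ->
  reach O (Config (While e c :: k) d w) (Config k d w).
Proof. by move=> h; apply: reach_step1; rewrite /= h. Qed.

Lemma reach_while_go O e c k d d' w : eval e d <> Nil -> computes O c d d' ->
  reach O (Config (While e c :: k) d w) (Config (While e c :: k) d' w).
Proof.
move=> h hc; apply: reach_step => /=; case E: (eval e d) => [|a b] //.
Qed.

(** * Programs acting on one component of the store *)

Fixpoint shift (e : expr) : expr :=
  match e with
  | Var => EHd Var
  | ENil => ENil
  | ECons a b => ECons (shift a) (shift b)
  | EHd a => EHd (shift a)
  | ETl a => ETl (shift a)
  end.

Lemma eval_shift e d r : eval (shift e) (Cons d r) = eval e d.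
Proof. by elim: e => [||a IHa b IHb|a IHa|a IHa] //=; rewrite ?IHa ?IHb. Qed.

(** In the case of [Ask], the answer is consed onto the whole store, and the assignment that follows
    moves it inside the first component. *)
Fixpoint lift (c : prog) : prog :=
  match c with
  | Assign e => Assign (ECons (shift e) (ETl Var))
  | Seq a b => Seq (lift a) (lift b)
  | While e a => While (shift e) (lift a)
  | Write => Write
  | Ask e => Seq (Ask (shift e))
      (Assign (ECons (ECons (EHd Var) (EHd (ETl Var))) (ETl (ETl Var))))
  end.

Lemma reach_lift O k0 r t s :
  reach O (Config (map lift (todo s) ++ k0) (Cons (store s) r) (written s))
    (let s' := iter t (step O) s in
     Config (map lift (todo s') ++ k0) (Cons (store s') r) (written s')).
Proof.
elim: t => [|t IH] /=; first exact: reach_refl.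
apply: reach_trans IH _; move: (iter t _ s) => {}s /=.
case: s => [[|c k] d w] /=; first exact: reach_refl.
case: c => [e|a b|e a||e] /=.
- by apply: reach_step1; rewrite /= eval_shift.
- exact: reach_step1.
- apply: reach_step; rewrite /= eval_shift.
  by case: (eval e d) => [|? ?] /=; apply: reach_refl.
- exact: reach_step1.
- do 2 apply: reach_step => /=; rewrite eval_shift.
  exact: reach_step1.
Qed.

Lemma computes_lift O c d d' r :
  computes O c d d' -> computes O (lift c) (Cons d r) (Cons d' r).
Proof.
move=> h k w; have [t ht] := h [::] w.
by have := reach_lift O k r t (Config [:: c] d w); rewrite ht.
Qed.

(** * Closure properties *)

Section Closure.
Variables (O : pred tree).
Context {A : Type} {tA : type0 A}.

Lemma comp_ext {X} {tX : type0 X} (f g : A -> X) :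
  f =1 g -> computable O f -> computable O g.
Proof. by move=> e [c hc]; exists c => a; rewrite -e. Qed.

Lemma comp_id : computable O (fun a : A => a).
Proof. exists (Assign Var) => a; exact: computes_assign. Qed.

Fixpoint quote (T : tree) : expr :=
  if T is Cons a b then ECons (quote a) (quote b) else ENil.

Lemma eval_quote T d : eval (quote T) d = T.
Proof. by elim: T => //= a -> b ->. Qed.

Lemma comp_const {X} {tX : type0 X} (x : X) : computable O (fun _ : A => x).
Proof.
exists (Assign (quote (code x))) => a k w.
by apply: reach_step1; rewrite /= eval_quote.
Qed.

Lemma comp_comp {X Y} {tX : type0 X} {tY : type0 Y} (g : X -> Y) (f : A -> X) :
  computable O g -> computable O f -> computable O (fun a => g (f a)).
Proof.
by move=> [c hc] [c' hc']; exists (Seq c' c) => a; apply: computes_seq.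
Qed.

Lemma comp_via {X} {tX : type0 X} (g : A -> tree) (f : A -> X) :
  (forall a, g a = code (f a)) -> computable O g -> computable O f.
Proof. by move=> e [c hc]; exists c => a; rewrite -e; apply: hc. Qed.

(** A tree is its own code, so both statements unfold to the same one. *)
Lemma comp_code {X} {tX : type0 X} (f : A -> X) :
  computable O f -> computable O (fun a => code (f a)).
Proof. by []. Qed.

Lemma comp_expr e (f : A -> tree) :
  computable O f -> computable O (fun a => eval e (f a)).
Proof.
move=> [c hc]; exists (Seq c (Assign e)) => a.
exact: computes_seq (hc a) (computes_assign _ _ _).
Qed.

Lemma comp_hd (f : A -> tree) : computable O f -> computable O (fun a => hd (f a)).
Proof. exact: (comp_expr (EHd Var)). Qed.

Lemma comp_tl (f : A -> tree) : computable O f -> computable O (fun a => tl (f a)).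
Proof. exact: (comp_expr (ETl Var)). Qed.

(** The argument is duplicated; [c'] acts on one copy, the two components are swapped, and [c] acts
    on the other copy. *)
Lemma comp_Cons (f g : A -> tree) : computable O f -> computable O g ->
  computable O (fun a => Cons (f a) (g a)).
Proof.
move=> [c hc] [c' hc'].
pose swap := Assign (ECons (ETl Var) (EHd Var)).
exists (Seq (Assign (ECons Var Var)) (Seq (lift c') (Seq swap (lift c)))) => a.
apply: computes_seq (computes_assign _ _ _) _.
apply: computes_seq (computes_lift _ (hc' a)) _.
apply: computes_seq (computes_assign _ _ _) _.
exact: computes_lift (hc a).
Qed.

Lemma comp_pair {X Y} {tX : type0 X} {tY : type0 Y} (f : A -> X) (g : A -> Y) :
  computable O f -> computable O g -> computable O (fun a => (f a, g a)).
Proof. exact: comp_Cons. Qed.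

Lemma comp_fst {X Y} {tX : type0 X} {tY : type0 Y} (f : A -> X * Y) :
  computable O f -> computable O (fun a => (f a).1).
Proof. by move=> h; apply: comp_via (comp_hd (comp_code h)). Qed.

Lemma comp_snd {X Y} {tX : type0 X} {tY : type0 Y} (f : A -> X * Y) :
  computable O f -> computable O (fun a => (f a).2).
Proof. by move=> h; apply: comp_via (comp_tl (comp_code h)). Qed.

(** Each branch is only required to be correct where it is taken, which is what a case analysis on
    an option needs. The language has no conditional: two flags control two loops, and the body of
    either loop clears both flags, so that exactly one body is run, once. *)
Lemma comp_if_on {X} {tX : type0 X} (b : A -> bool) (f g : A -> X) :
  computable O b ->
  (exists c, forall a, b a -> computes O c (code a) (code (f a))) ->
  (exists c, forall a, ~~ b a -> computes O c (code a) (code (g a))) ->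
  computable O (fun a => if b a then f a else g a).
Proof.
move=> hb [cf hf] [cg hg].
have [c0 h0] : computable O (fun a => (b a, (~~ false, a))).
  by apply: comp_pair hb (comp_pair (comp_const _) comp_id).
pose branch c := Seq (Assign (ETl (ETl Var)))
  (Seq c (Assign (ECons ENil (ECons ENil Var)))).
have hbr c a d : computes O c (code a) d ->
    computes O (branch c) (code (b a, (~~ false, a))) (Cons Nil (Cons Nil d)).
  move=> h; apply: computes_seq (computes_assign _ _ _) _.
  exact: computes_seq h (computes_assign _ _ _).
exists (Seq c0 (Seq (While (EHd Var) (branch cf))
  (Seq (While (EHd (ETl Var)) (branch cg)) (Assign (ETl (ETl Var)))))) => a.
apply: computes_seq (h0 a) _ => k w; apply: reach_step => /=.
case E: (b a).
- have := hbr _ _ _ (hf _ E); rewrite /= E => ht.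
  apply: reach_trans (reach_while_go _ _ _ ht) _ => //.
  apply: reach_trans (reach_while_stop _ _ _ _ _) _ => //.
  apply: reach_step => /=.
  apply: reach_trans (reach_while_stop _ _ _ _ _) _ => //.
  exact: reach_step1.
- have := hbr _ _ _ (hg _ (negbT E)); rewrite /= E => he.
  apply: reach_trans (reach_while_stop _ _ _ _ _) _ => //.
  apply: reach_step => /=.
  apply: reach_trans (reach_while_go _ _ _ he) _ => //.
  apply: reach_trans (reach_while_stop _ _ _ _ _) _ => //.
  exact: reach_step1.
Qed.

Lemma comp_if {X} {tX : type0 X} (b : A -> bool) (f g : A -> X) :
  computable O b -> computable O f -> computable O g ->
  computable O (fun a => if b a then f a else g a).
Proof. by move=> hb [cf hf] [cg hg]; apply: comp_if_on hb _ _; [exists cf|exists cg]. Qed.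

Lemma comp_ask (f : A -> tree) :
  computable O f -> computable O (fun a => O (f a)).
Proof.
move=> [c hc]; exists (Seq c (Seq (Ask Var) (Assign (EHd Var)))) => a.
apply: computes_seq (hc a) _ => k w.
by do 3 (apply: reach_step => /=); apply: reach_refl.
Qed.

Lemma comp_negb (f : A -> bool) : computable O f -> computable O (fun a => ~~ f a).
Proof.
move=> h; apply: (@comp_ext bool _ (fun a => if f a then false else true)).
  by move=> a; case: (f a).
exact: comp_if h (comp_const _) (comp_const _).
Qed.

Lemma comp_andb (f g : A -> bool) : computable O f -> computable O g ->
  computable O (fun a => f a && g a).
Proof. by move=> hf hg; apply: comp_if hf hg (comp_const _). Qed.

Lemma comp_orb (f g : A -> bool) : computable O f -> computable O g ->
  computable O (fun a => f a || g a).
Proof. by move=> hf hg; apply: comp_if hf (comp_const _) hg. Qed.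

Definition is_nil (T : tree) : bool := if T is Nil then true else false.

Lemma comp_is_nil (f : A -> tree) :
  computable O f -> computable O (fun a => is_nil (f a)).
Proof.
move=> [c hc].
(* A flag [true] is placed beside the tree. If the tree is not [Nil], the loop erases the flag, and
   the tree too, which ends the loop. *)
exists (Seq c (Seq (Assign (ECons Var (quote (code true))))
  (Seq (While (EHd Var) (Assign (ECons ENil ENil))) (Assign (ETl Var))))) => a.
apply: computes_seq (hc a) _ => k w; do 3 (apply: reach_step => /=).
case: (f a) => [|x y] /=.
  apply: reach_trans (reach_while_stop _ _ _ _ _) _ => //.
  exact: reach_step1.
apply: reach_trans (reach_while_go _ _ _ (computes_assign _ _ _)) _ => //.
apply: reach_trans (reach_while_stop _ _ _ _ _) _ => //.
exact: reach_step1.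
Qed.

End Closure.

Lemma comp2 O {A X Y Z} {tA : type0 A} {tX : type0 X} {tY : type0 Y}
    {tZ : type0 Z} (F : X -> Y -> Z) (f : A -> X) (g : A -> Y) :
  computable O (fun z : X * Y => F z.1 z.2) ->
  computable O f -> computable O g -> computable O (fun a => F (f a) (g a)).
Proof. by move=> hF hf hg; apply: comp_comp hF (comp_pair hf hg). Qed.

Lemma comp3 O {A X Y Z V} {tA : type0 A} {tX : type0 X} {tY : type0 Y}
    {tZ : type0 Z} {tV : type0 V} (F : X -> Y -> Z -> V)
    (f : A -> X) (g : A -> Y) (h : A -> Z) :
  computable O (fun z : X * Y * Z => F z.1.1 z.1.2 z.2) ->
  computable O f -> computable O g -> computable O h ->
  computable O (fun a => F (f a) (g a) (h a)).
Proof. by move=> hF hf hg hh; apply: comp_comp hF (comp_pair (comp_pair hf hg) hh). Qed.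

Lemma comp_fst0 O {X Y} {tX : type0 X} {tY : type0 Y} :
  computable O (@fst X Y).
Proof. exact: comp_fst (comp_id _). Qed.

Lemma comp_snd0 O {X Y} {tX : type0 X} {tY : type0 Y} :
  computable O (@snd X Y).
Proof. exact: comp_snd (comp_id _). Qed.

(* Rules for further operations are added by redefining this tactic. *)
Ltac comp_rule := fail.

Ltac comp := cbv beta zeta;
  match goal with
  | |- computable _ (fun a => a) => exact (comp_id _)
  | |- computable _ (@fst _ _) => exact (comp_fst0 _)
  | |- computable _ (@snd _ _) => exact (comp_snd0 _)
  | |- computable _ (fun _ => ?x) => exact (comp_const _ x)
  | H : computable _ ?f |- computable _ ?f => exact H
  | H : computable _ ?f |- computable _ (fun a => ?f a) => exact H
  | |- computable _ (fun a => fst (@?f a)) => refine (comp_fst (f := f) _); comp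
  | |- computable _ (fun a => snd (@?f a)) => refine (comp_snd (f := f) _); comp
  | |- computable _ (fun a => (@?f a, @?g a)) =>
      refine (comp_pair (f := f) (g := g) _ _); comp
  | |- computable _ (fun a => if _ then _ else _) => apply: comp_if; comp
  | |- computable _ (fun a => hd (@?f a)) => refine (comp_hd (f := f) _); comp
  | |- computable _ (fun a => tl (@?f a)) => refine (comp_tl (f := f) _); comp
  | |- computable _ (fun a => Cons (@?f a) (@?g a)) =>
      refine (comp_Cons (f := f) (g := g) _ _); comp
  | |- computable _ (fun a => ~~ (@?f a)) => refine (comp_negb (f := f) _); comp
  | |- computable _ (fun a => @?f a && @?g a) =>
      refine (comp_andb (f := f) (g := g) _ _); comp
  | |- computable _ (fun a => @?f a || @?g a) =>
      refine (comp_orb (f := f) (g := g) _ _); comp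
  | |- computable _ (fun a => is_nil (@?f a)) =>
      refine (comp_is_nil (f := f) _); comp
  | |- computable _ (fun a => code (@?f a)) => refine (comp_code (f := f) _); comp
  | H : computable _ ?g |- computable _ (fun a => ?g (@?f a)) =>
      refine (comp_comp (f := f) H _); comp
  | H : computable _ (fun z => ?F z.1 z.2)
    |- computable _ (fun a => ?F (@?f a) (@?g a)) =>
      refine (comp2 (f := f) (g := g) H _ _); comp
  | H : computable _ (fun z => ?F z.1.1 z.1.2 z.2)
    |- computable _ (fun a => ?F (@?f a) (@?g a) (@?h a)) =>
      refine (comp3 (f := f) (g := g) (h := h) H _ _ _); comp
  | _ => comp_rule
  end.

Fixpoint fold (a : tree) (g : tree -> tree -> tree) (T : tree) : tree :=
  if T is Cons x y then g (fold a g x) (fold a g y) else a.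

(* The program keeps a stack of pending subtrees and a stack of values. *)
Lemma comp_fold O {A P} {tA : type0 A} {tP : type0 P} (p : A -> P)
    (a : P -> tree) (G : P -> tree -> tree -> tree) (T : A -> tree) :
  computable O p -> computable O a ->
  computable O (fun z : P * tree * tree => G z.1.1 z.1.2 z.2) ->
  computable O T ->
  computable O (fun x => fold (a (p x)) (G (p x)) (T x)).
Proof.
move=> hp ha hG hT.
(* A pending item with head [Nil] holds a subtree to evaluate; an item with another head asks to
   combine the two topmost values, of which the upper one comes from the right child. *)
pose body (s : P * (tree * tree)) : P * (tree * tree) :=
  let item := hd s.2.1 in let rest := tl s.2.1 in let vs := s.2.2 in
  if is_nil (hd item) then
    if is_nil (tl item) then (s.1, (rest, Cons (a s.1) vs))
    else (s.1, (Cons (Cons Nil (hd (tl item))) (Cons (Cons Nil (tl (tl item)))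
                 (Cons (Cons (Cons Nil Nil) Nil) rest)), vs))
  else (s.1, (rest, Cons (G s.1 (hd (tl vs)) (hd vs)) (tl (tl vs)))).
have [cb hb] : computable O body.
  by rewrite /body; comp.
pose loop := While (EHd (ETl Var)) cb.
have main q U rest vs k w :
    reach O (Config (loop :: k) (code (q, (Cons (Cons Nil U) rest, vs))) w)
            (Config (loop :: k) (code (q, (rest, Cons (fold (a q) (G q) U) vs))) w).
  elim: U rest vs => [|x IHx y IHy] rest vs.
    exact: reach_while_go (hb _).
  apply: reach_trans (reach_while_go _ _ _ (hb _)) _ => //.
  rewrite {1}/body /=.
  apply: reach_trans (IHx _ _) _; apply: reach_trans (IHy _ _) _.
  by apply: reach_trans (reach_while_go _ _ _ (hb _)) _ => //; apply: reach_refl.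
have [c0 h0] : computable O (fun x => (p x, (Cons (Cons Nil (T x)) Nil, Nil))).
  by comp.
exists (Seq c0 (Seq loop (Assign (EHd (ETl (ETl Var)))))) => x.
apply: computes_seq (h0 x) _ => k w; apply: reach_step => /=.
apply: reach_trans (main _ _ _ _ _ _) _.
apply: reach_trans (reach_while_stop _ _ _ _ _) _ => //.
exact: reach_step1.
Qed.

(** * Numbers, options and sequences *)

Section Iteration.
Variable O : pred tree.
Context {A : Type} {tA : type0 A}.

Lemma comp_iter {X} {tX : type0 X} (n : A -> nat) (G : A -> X -> X)
    (x : A -> X) :
  computable O n -> computable O (fun z : A * X => G z.1 z.2) ->
  computable O x -> computable O (fun a => iter (n a) (G a) (x a)).
Proof.
move=> hn [c hc] hx.
pose body := Seq (Assign (ECons (ETl Var) (ECons (EHd (ETl Var)) (ETl (EHd Var)))))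
  (Seq (lift c) (Assign (ECons (ETl (ETl Var)) (ECons (EHd (ETl Var)) (EHd Var))))).
have hb m a y : computes O body (Cons (code_nat m.+1) (Cons (code a) (code y)))
    (Cons (code_nat m) (Cons (code a) (code (G a y)))).
  apply: computes_seq (computes_assign _ _ _) _.
  by apply: computes_seq (computes_lift _ (hc (a, y))) (computes_assign _ _ _).
have [c0 h0] : computable O (fun a => (n a, (a, x a))) by comp.
exists (Seq c0 (Seq (While (EHd Var) body) (Assign (ETl (ETl Var))))) => a.
apply: computes_seq (h0 a) _ => k w; apply: reach_step => /=.
move: (n a) (x a) => m; elim: m => [|m IH] y.
  apply: reach_trans (reach_while_stop _ _ _ _ _) _ => //.
  exact: reach_step1.
apply: reach_trans (reach_while_go _ _ _ (hb _ _ _)) _ => //.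
by rewrite iterSr; apply: IH.
Qed.

Lemma comp_succ (f : A -> nat) : computable O f -> computable O (fun a => (f a).+1).
Proof. by move=> h; apply: comp_via (comp_Cons (comp_const O Nil) (comp_code h)). Qed.

Lemma comp_pred (f : A -> nat) : computable O f -> computable O (fun a => (f a).-1).
Proof.
move=> h; apply: comp_via (comp_tl (comp_code h)) => a; by case: (f a).
Qed.

End Iteration.
Ltac comp_rule_succ :=
  match goal with
  | |- computable _ (fun a => (@?f a).+1) =>
      refine (comp_succ (f := f) _); comp
  | |- computable _ (fun a => (@?f a).-1) =>
      refine (comp_pred (f := f) _); comp
  end.

Ltac comp_rule ::= comp_rule_succ.

(** The length of the right spine decodes numbers, and gives the size of a coded sequence. *)
Fixpoint len (T : tree) : nat := if T is Cons _ y then (len y).+1 else 0.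

Lemma len_code_nat n : len (code_nat n) = n.
Proof. by elim: n => //= n ->. Qed.

Section Arith.
Variable O : pred tree.
Context {A : Type} {tA : type0 A}.

Lemma comp_addn (f g : A -> nat) : computable O f -> computable O g ->
  computable O (fun a => f a + g a).
Proof.
move=> hf hg; apply: (@comp_ext _ _ _ _ _ (fun a => iter (f a) succn (g a))).
  by move=> a; rewrite iter_succn addnC.
by apply: comp_iter => //; comp.
Qed.

Lemma comp_subn (f g : A -> nat) : computable O f -> computable O g ->
  computable O (fun a => f a - g a).
Proof.
move=> hf hg; apply: (@comp_ext _ _ _ _ _ (fun a => iter (g a) predn (f a))).
  by move=> a; rewrite iter_predn.
by apply: comp_iter => //; comp.
Qed.

Lemma comp_leq (f g : A -> nat) : computable O f -> computable O g ->
  computable O (fun a => f a <= g a).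
Proof.
move=> hf hg.
apply: (@comp_ext _ _ _ _ _ (fun a => is_nil (code (f a - g a)))).
  by move=> a; rewrite /leq; case: (_ - _).
exact: comp_is_nil (comp_code (comp_subn hf hg)).
Qed.

Lemma comp_eqn (f g : A -> nat) : computable O f -> computable O g ->
  computable O (fun a => f a == g a).
Proof.
move=> hf hg; apply: comp_ext (comp_andb (comp_leq hf hg) (comp_leq hg hf)).
by move=> a; rewrite eqn_leq.
Qed.

Lemma comp_len (f : A -> tree) :
  computable O f -> computable O (fun a => len (f a)).
Proof.
move=> hf; apply: (@comp_via _ _ _ _ _ (fun a => fold Nil (fun _ => Cons Nil) (f a))).
  by move=> a; elim: (f a) => //= x _ y ->.
by apply: (comp_fold (p := id) (a := fun _ => Nil)
  (G := fun _ _ => Cons Nil)); comp.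
Qed.

Lemma comp_cons {X} {tX : type0 X} (x : A -> X) (l : A -> seq X) :
  computable O x -> computable O l -> computable O (fun a => x a :: l a).
Proof. by move=> hx hl; apply: comp_via (comp_Cons (comp_code hx) (comp_code hl)). Qed.

Lemma comp_sizew (l : A -> word) : computable O l -> computable O (fun a => size (l a)).
Proof.
move=> hl; apply: comp_ext (comp_len (comp_code hl)) => a /=.
by elim: (l a) => //= b s ->.
Qed.

Lemma comp_foldl {X Y} {tX : type0 X} {tY : type0 Y} (G : A -> Y -> X -> Y)
    (y : A -> Y) (l : A -> seq X) :
  computable O (fun z : A * Y * X => G z.1.1 z.1.2 z.2) ->
  computable O y -> computable O l ->
  computable O (fun a => foldl (G a) (y a) (l a)).
Proof.
move=> [c hc] hy hl.
pose body := Seq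
  (Assign (ECons (ECons (ETl Var) (EHd (EHd Var)))
                 (ECons (ETl (EHd Var)) (EHd (ETl Var)))))
  (Seq (lift c) (Assign (ECons (EHd (ETl Var)) (ECons (ETl (ETl Var)) (EHd Var))))).
have hb x s a z : computes O body (code (x :: s, (a, z))) (code (s, (a, G a z x))).
  apply: computes_seq (computes_assign _ _ _) _.
  exact: computes_seq (computes_lift _ (hc (a, z, x))) (computes_assign _ _ _).
have [c0 h0] : computable O (fun a => (l a, (a, y a))) by comp.
exists (Seq c0 (Seq (While (EHd Var) body) (Assign (ETl (ETl Var))))) => a.
apply: computes_seq (h0 a) _ => k w; apply: reach_step => /=.
move: (l a) (y a) => s; elim: s => [|x s IH] z /=.
  apply: reach_trans (reach_while_stop _ _ _ _ _) _ => //.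
  exact: reach_step1.
exact: reach_trans (reach_while_go _ _ _ (hb _ _ _ _)) (IH _).
Qed.

End Arith.
Ltac comp_rule_arith :=
  match goal with
  | |- computable _ (fun a => (@?f a) + (@?g a)) =>
      refine (comp_addn (f := f) (g := g) _ _); comp
  | |- computable _ (fun a => (@?f a) - (@?g a)) =>
      refine (comp_subn (f := f) (g := g) _ _); comp
  | |- computable _ (fun a => (@?f a) == (@?g a)) =>
      refine (comp_eqn (f := f) (g := g) _ _); comp
  | |- computable _ (fun a => (@?f a) <= (@?g a)) =>
      refine (comp_leq (f := f) (g := g) _ _); comp
  | |- computable _ (fun a => len (@?f a)) =>
      refine (comp_len (f := f) _); comp
  | |- computable _ (fun a => (@?x a) :: (@?l a)) =>
      refine (comp_cons (x := x) (l := l) _ _); comp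
  | |- computable _ (fun a => size (@?l a)) =>
      refine (comp_sizew (l := l) _); comp
  | _ => comp_rule_succ
  end.

Ltac comp_rule ::= comp_rule_arith.

Section Folds.
Variable O : pred tree.
Context {A : Type} {tA : type0 A} {X Y : Type} {tX : type0 X} {tY : type0 Y}.

Lemma comp_rev (l : A -> seq X) : computable O l -> computable O (fun a => rev (l a)).
Proof.
move=> hl.
apply: (@comp_ext _ _ _ _ _ (fun a => foldl (fun s x => x :: s) [::] (l a))).
  move=> a; rewrite -{1}(revK (l a)) foldl_rev.
  by elim: (rev (l a)) => //= x s ->.
by apply: comp_foldl hl; comp.
Qed.

Lemma comp_foldr (G : A -> X -> Y -> Y) (y : A -> Y) (l : A -> seq X) :
  computable O (fun z : A * X * Y => G z.1.1 z.1.2 z.2) ->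
  computable O y -> computable O l ->
  computable O (fun a => foldr (G a) (y a) (l a)).
Proof.
move=> hG hy hl.
apply: (@comp_ext _ _ _ _ _
  (fun a => foldl (fun z x => G a x z) (y a) (rev (l a)))).
  by move=> a; rewrite foldl_rev.
apply: comp_foldl hy (comp_rev hl).
by apply: (comp3 hG); comp.
Qed.

End Folds.

Section Sequences.
Variable O : pred tree.
Context {A : Type} {tA : type0 A} {X Y : Type} {tX : type0 X} {tY : type0 Y}.

Lemma comp_filter (P : A -> X -> bool) (l : A -> seq X) :
  computable O (fun z : A * X => P z.1 z.2) -> computable O l ->
  computable O (fun a => filter (P a) (l a)).
Proof.
move=> hP hl; apply: (@comp_ext _ _ _ _ _
  (fun a => foldr (fun x s => if P a x then x :: s else s) [::] (l a))).
  by move=> a; elim: (l a) => //= x s ->.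
apply: comp_foldr hl; last comp.
by apply: comp_if; [apply: (comp2 hP)| |]; comp.
Qed.

Lemma comp_has (P : A -> X -> bool) (l : A -> seq X) :
  computable O (fun z : A * X => P z.1 z.2) -> computable O l ->
  computable O (fun a => has (P a) (l a)).
Proof.
move=> hP hl; apply: (@comp_ext _ _ _ _ _
  (fun a => ~~ is_nil (code (filter (P a) (l a))))).
  by move=> a; elim: (l a) => //= x s <-; case: (P a x).
by have h := comp_filter hP hl; comp.
Qed.

Lemma comp_map (F : A -> X -> Y) (l : A -> seq X) :
  computable O (fun z : A * X => F z.1 z.2) -> computable O l ->
  computable O (fun a => map (F a) (l a)).
Proof.
move=> hF hl; apply: (@comp_ext _ _ _ _ _
  (fun a => foldr (fun x s => F a x :: s) [::] (l a))).
  by move=> a; elim: (l a) => //= x s ->.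
apply: comp_foldr hl; last comp.
by apply: comp_cons; [apply: (comp2 hF)|]; comp.
Qed.

Lemma comp_cat (l1 l2 : A -> seq X) :
  computable O l1 -> computable O l2 -> computable O (fun a => l1 a ++ l2 a).
Proof.
move=> h1 h2; apply: (@comp_ext _ _ _ _ _ (fun a => foldr cons (l2 a) (l1 a))).
  by move=> a; elim: (l1 a) => //= x s ->.
by apply: comp_foldr h2 h1; comp.
Qed.

Lemma comp_size (l : A -> seq X) : computable O l -> computable O (fun a => size (l a)).
Proof.
move=> hl; apply: comp_ext (comp_len (comp_code hl)) => a /=.
by elim: (l a) => //= x s ->.
Qed.

Lemma comp_Some (f : A -> X) : computable O f -> computable O (fun a => Some (f a)).
Proof.
by move=> h; apply: comp_via (comp_Cons (comp_const O Nil) (comp_code h)).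
Qed.

Lemma comp_option_case (o : A -> option X) (F : A -> X -> Y) (y : A -> Y) :
  computable O o -> computable O (fun z : A * X => F z.1 z.2) ->
  computable O y ->
  computable O (fun a => if o a is Some x then F a x else y a).
Proof.
(* The match is repeated in both branches of a test, each of which is then computed only in its own
   case. In the case of [Some x], the tail of the code is the code of [x]. *)
move=> ho [cF hF] [cy hy]; apply: (@comp_ext _ _ _ _ _ (fun a =>
  if is_nil (code (o a)) then if o a is Some x then F a x else y a
  else if o a is Some x then F a x else y a)).
  by move=> a; case: (o a).
have [c0 h0] : computable O (fun a => (a, tl (code (o a)))) by comp.
apply: comp_if_on; first comp.
  by exists cy => a; case: (o a) => //= _; apply: hy.
exists (Seq c0 cF) => a; case E: (o a) => [x|] //= _.
by apply: computes_seq (hF (a, x)); have := h0 a; rewrite E.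
Qed.

Lemma comp_isSome (o : A -> option X) :
  computable O o -> computable O (fun a => isSome (o a)).
Proof.
move=> h; apply: (@comp_ext _ _ _ _ _ (fun a => ~~ is_nil (code (o a)))).
  by move=> a; case: (o a).
by comp.
Qed.

End Sequences.
Ltac comp_rule_seq :=
  match goal with
  | |- computable _ (fun a => (@?l1 a) ++ (@?l2 a)) =>
      refine (comp_cat (l1 := l1) (l2 := l2) _ _); comp
  | |- computable _ (fun a => size (@?l a)) =>
      refine (comp_size (l := l) _); comp
  | |- computable _ (fun a => Some (@?f a)) =>
      refine (comp_Some (f := f) _); comp
  | |- computable _ (fun a => filter _ (@?l a)) =>
      refine (comp_filter (l := l) _ _); comp
  | |- computable _ (fun a => has _ (@?l a)) =>
      refine (comp_has (l := l) _ _); comp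
  | |- computable _ (fun a => map _ (@?l a)) =>
      refine (comp_map (l := l) _ _); comp
  | |- computable _ (fun a => iter (@?n a) _ (@?x a)) =>
      refine (comp_iter (n := n) (x := x) _ _ _); comp
  | |- computable _ (fun a => if _ is Some _ then _ else _) =>
      apply: comp_option_case; comp
  | |- computable _ (fun a => isSome (@?o a)) =>
      refine (comp_isSome (o := o) _); comp
  | _ => comp_rule_arith
  end.

Ltac comp_rule ::= comp_rule_seq.

Section NatSequences.
Variable O : pred tree.
Context {A : Type} {tA : type0 A}.

Lemma comp_iota (n : A -> nat) :
  computable O n -> computable O (fun a => iota 0 (n a)).
Proof.
move=> hn; apply: (@comp_ext _ _ _ _ _
  (fun a => iter (n a) (fun s => 0 :: map succn s) [::])).
  by move=> a; elim: (n a) => //= m ->; rewrite -(iotaDl 1).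
apply: comp_iter => //; last comp.
apply: comp_cons; first comp.
by apply: (comp_map (F := fun _ => succn)); comp.
Qed.

Lemma comp_has_eq (m : A -> nat) (l : A -> seq nat) :
  computable O m -> computable O l -> computable O (fun a => m a \in l a).
Proof.
move=> hm hl; apply: (@comp_ext _ _ _ _ _ (fun a => has (fun x => x == m a) (l a))).
  by move=> a; rewrite has_pred1.
by apply: comp_has hl; comp.
Qed.

Lemma comp_sumn (l : A -> seq nat) :
  computable O l -> computable O (fun a => sumn (l a)).
Proof. by move=> hl; apply: comp_foldr hl; comp. Qed.

End NatSequences.
Ltac comp_rule_nat :=
  match goal with
  | |- computable _ (fun a => iota 0 (@?n a)) =>
      refine (comp_iota (n := n) _); comp
  | |- computable _ (fun a => (@?m a) \in (@?l a)) =>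
      refine (comp_has_eq (m := m) (l := l) _ _); comp
  | |- computable _ (fun a => sumn (@?l a)) =>
      refine (comp_sumn (l := l) _); comp
  | _ => comp_rule_seq
  end.

Ltac comp_rule ::= comp_rule_nat.

(** * Short words, quotation and recursion on trees *)

Fixpoint words (k : nat) : seq word :=
  if k is k'.+1 then
    [::] :: map (cons true) (words k') ++ map (cons false) (words k')
  else [:: [::]].

Lemma mem_words (k : nat) (p : word) : size p <= k -> p \in (words k : seq (seq bool)).
Proof.
elim: k p => [|k IH] [|b p] //= h; rewrite inE mem_cat /=.
by apply/orP; case: b; [left|right]; apply/mapP; exists p => //; apply: IH.
Qed.

Lemma comp_words O {A} {tA : type0 A} (k : A -> nat) :
  computable O k -> computable O (fun a => words (k a)).
Proof.
move=> hk; apply: (@comp_ext _ _ _ _ _ (fun a => iter (k a)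
   (fun s => [::] :: map (cons true) s ++ map (cons false) s) [:: [::]])).
  by move=> a; elim: (k a) => //= m ->.
apply: comp_iter => //; last comp.
apply: comp_cons; first comp; apply: comp_cat.
  by apply: (comp_map (F := fun _ => cons true)); comp.
by apply: (comp_map (F := fun _ => cons false)); comp.
Qed.
Ltac comp_rule_words :=
  match goal with
  | |- computable _ (fun a => words (@?k a)) =>
      refine (comp_words (k := k) _); comp
  | _ => comp_rule_nat
  end.

Ltac comp_rule ::= comp_rule_words.

Lemma comp_quote O {A} {tA : type0 A} (T : A -> tree) :
  computable O T -> computable O (fun a => quote (T a)).
Proof.
move=> hT; apply: (@comp_via _ _ _ _ _ (fun a =>
   fold (code ENil) (fun x y => Cons (code_nat 2) (Cons x y)) (T a))).
  by move=> a; elim: (T a) => //= x -> y ->.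
by apply: (comp_fold (p := id) (a := fun _ => code ENil)
  (G := fun _ x y => Cons (code_nat 2) (Cons x y))); comp.
Qed.

(* Course-of-values recursion: the value at [Cons x y] may depend on the values
   at [y] and at its two children, which are the arguments of an instruction
   whose tag is [x]. *)
Definition treerec_table (G : tree -> tree -> tree -> tree -> tree -> tree) :
  tree -> tree :=
  fold (Cons Nil (Cons Nil (Cons Nil Nil)))
    (fun rx ry => Cons (Cons (hd rx) (hd ry))
       (Cons (G (hd rx) (hd ry) (hd (tl ry)) (hd (tl (tl ry))) (tl (tl (tl ry))))
             (Cons (hd (tl rx)) (hd (tl ry))))).

Definition treerec G (T : tree) : tree := hd (tl (treerec_table G T)).

Lemma treerec_table_Cons G x y : treerec_table G (Cons x y) =
  let rx := treerec_table G x in let ry := treerec_table G y in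
  Cons (Cons (hd rx) (hd ry))
    (Cons (G (hd rx) (hd ry) (hd (tl ry)) (hd (tl (tl ry))) (tl (tl (tl ry))))
          (Cons (hd (tl rx)) (hd (tl ry)))).
Proof. by []. Qed.

Lemma treerec_tableE G T : treerec_table G T =
  Cons T (Cons (treerec G T) (Cons (treerec G (hd T)) (treerec G (tl T)))).
Proof.
have h U : hd (treerec_table G U) = U.
  by elim: U => // x hx y hy; rewrite treerec_table_Cons /= hx hy.
by case: T => [|x y] //; rewrite /treerec treerec_table_Cons /= !h.
Qed.

Lemma treerecE G x y : treerec G (Cons x y) =
  G x y (treerec G y) (treerec G (hd y)) (treerec G (tl y)).
Proof. by rewrite {1}/treerec treerec_table_Cons !treerec_tableE. Qed.

Lemma comp_treerec O {A P} {tA : type0 A} {tP : type0 P} (p : A -> P) G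
    (T : A -> tree) :
  computable O p ->
  computable O (fun z : P * (tree * tree * (tree * (tree * tree))) =>
    G z.1 z.2.1.1 z.2.1.2 z.2.2.1 z.2.2.2.1 z.2.2.2.2) ->
  computable O T ->
  computable O (fun a => treerec (G (p a)) (T a)).
Proof.
move=> hp hG hT; apply: comp_hd; apply: comp_tl.
apply: (comp_fold (p := p) (a := fun _ => _) (G := fun q rx ry =>
  Cons (Cons (hd rx) (hd ry))
       (Cons (G q (hd rx) (hd ry) (hd (tl ry)) (hd (tl (tl ry))) (tl (tl (tl ry))))
             (Cons (hd (tl rx)) (hd (tl ry)))))) => //; first comp.
apply: comp_Cons; first comp.
apply: comp_Cons; last comp.
pose args (z : P * tree * tree) := (z.1.1, ((hd z.1.2, hd z.2),
  (hd (tl z.2), (hd (tl (tl z.2)), tl (tl (tl z.2)))))).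
by apply: (comp_comp (f := args) hG); rewrite /args; comp.
Qed.

(** * An interpreter *)

(** The tests follow the tags of [code_expr]. A unary constructor has [y] itself as its argument,
    while the arguments of [ECons] are the two children of [y]. *)
Definition eval_rec (d x y vy vhy vty : tree) : tree :=
  if len x == 0 then d else if len x == 1 then Nil
  else if len x == 2 then Cons vhy vty
  else if len x == 3 then hd vy else tl vy.

Lemma treerec_eval d e : treerec (eval_rec d) (code_expr e) = eval e d.
Proof.
elim: e => [||a IHa b IHb|a IHa|a IHa] //=; rewrite treerecE /eval_rec /=.
- by rewrite IHa IHb.
- by rewrite IHa.
- by rewrite IHa.
Qed.

Lemma comp_eval_code O {A} {tA : type0 A} (T d : A -> tree) :
  computable O T -> computable O d ->
  computable O (fun a => treerec (eval_rec (d a)) (T a)).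
Proof. by move=> hT hd; apply: (comp_treerec hd _ hT); rewrite /eval_rec; comp. Qed.

Fixpoint is_nat (T : tree) : bool :=
  if T is Cons x y then is_nil x && is_nat y else true.

Lemma is_natP T : reflect (T = code_nat (len T)) (is_nat T).
Proof.
apply: (iffP idP) => [|->]; last by elim: (len T).
by elim: T => //= x _ y IH /andP[]; case: x => // _ /IH {1}->.
Qed.

Lemma comp_is_nat O {A} {tA : type0 A} (T : A -> tree) :
  computable O T -> computable O (fun a => is_nat (T a)).
Proof.
move=> hT; pose g rx ry := Cons (code_bool true) (if is_nil (hd rx) then tl ry else Nil).
pose h := fold (Cons Nil (code_bool true)) g.
have e U : h U = Cons (code (~~ is_nil U)) (code (is_nat U)).
  elim: U => // x IHx y IHy.
  rewrite /h /= -/h IHx IHy /g /=; by case: (x).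
apply: (@comp_ext _ _ _ _ _ (fun a => ~~ is_nil (tl (h (T a))))).
  by move=> a; rewrite e /=; case: (is_nat _).
apply: comp_negb; apply: comp_is_nil; apply: comp_tl.
by apply: (comp_fold (p := id) (a := fun _ => Cons Nil (code_bool true))
  (G := fun _ => g)); rewrite /g; comp.
Qed.
Ltac comp_rule_tree :=
  match goal with
  | |- computable _ (fun a => treerec (eval_rec (@?d a)) (@?T a)) =>
      refine (comp_eval_code (T := T) (d := d) _ _); comp
  | |- computable _ (fun a => is_nat (@?T a)) =>
      refine (comp_is_nat (T := T) _); comp
  | _ => comp_rule_words
  end.

Ltac comp_rule ::= comp_rule_tree.

Definition is_expr_rec (x y vy vhy vty : tree) : tree :=
  if is_nat x then
    if len x <= 1 then code (is_nil y)
    else if len x == 2 then code (~~ is_nil vhy && ~~ is_nil vty)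
    else if len x <= 4 then vy else Nil
  else Nil.

Definition is_expr (T : tree) : bool := ~~ is_nil (treerec is_expr_rec T).

Lemma is_exprP T : is_expr T <-> exists e, T = code_expr e.
Proof.
split; last first.
  case=> e ->; rewrite /is_expr.
  elim: e => [||a IHa b IHb|a IHa|a IHa] //=; rewrite treerecE /is_expr_rec //=.
  by rewrite IHa IHb.
(* The induction also carries the claim for both children, since the arguments of [ECons] lie two
   levels below the root. *)
pose P U := is_expr U -> exists e, U = code_expr e.
suff h U : P U /\ P (hd U) /\ P (tl U) by have [] := h T.
elim: U => [|x [Hx _] y [Hy [Hhy Hty]]] //=; split=> //.
rewrite /P /is_expr treerecE /is_expr_rec; case: is_natP => // ->.
rewrite len_code_nat; case: (len x) => [|[|[|[|[|n]]]]] //=.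
- by case: (y) => // _; exists Var.
- by case: (y) => // _; exists ENil.
- case E : (_ && _) => // _; case/andP: E => /Hhy [a ha] /Hty [b hb].
  exists (ECons a b); rewrite /= -ha -hb.
  by case: (y) ha => //=; case: (a).
- by move=> /Hy [a ->]; exists (EHd a).
- by move=> /Hy [a ->]; exists (ETl a).
Qed.

Lemma comp_is_expr O {A} {tA : type0 A} (T : A -> tree) :
  computable O T -> computable O (fun a => is_expr (T a)).
Proof.
move=> hT; apply: comp_negb; apply: comp_is_nil.
by apply: (comp_treerec (p := id) (G := fun _ => is_expr_rec) _ _ hT);
   rewrite /is_expr_rec; comp.
Qed.
Ltac comp_rule_expr :=
  match goal with
  | |- computable _ (fun a => is_expr (@?T a)) =>
      refine (comp_is_expr (T := T) _); comp
  | _ => comp_rule_tree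
  end.

Ltac comp_rule ::= comp_rule_expr.

Definition is_prog_rec (x y vy vhy vty : tree) : tree :=
  if is_nat x then
    if len x == 0 then code (is_expr y)
    else if len x == 1 then code (~~ is_nil vhy && ~~ is_nil vty)
    else if len x == 2 then code (is_expr (hd y) && ~~ is_nil vty)
    else if len x == 3 then code (is_nil y)
    else if len x == 4 then code (is_expr y) else Nil
  else Nil.

Definition is_prog (T : tree) : bool := ~~ is_nil (treerec is_prog_rec T).

Lemma is_exprW e : is_expr (code_expr e).
Proof. by apply/is_exprP; exists e. Qed.

Lemma is_progP T : is_prog T <-> exists c, T = code_prog c.
Proof.
split; last first.
  case=> e ->; rewrite /is_prog.
  elim: e => [e|a IHa b IHb|e a IHa||e] //=; rewrite treerecE /is_prog_rec /=.
  - by rewrite is_exprW.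
  - by rewrite IHa IHb.
  - by rewrite is_exprW IHa.
  - by rewrite is_exprW.
pose P U := is_prog U -> exists e, U = code_prog e.
suff h U : P U /\ P (hd U) /\ P (tl U) by have [] := h T.
elim: U => [|x [Hx _] y [Hy [Hhy Hty]]] //=; split=> //.
rewrite /P /is_prog treerecE /is_prog_rec; case: is_natP => // ->.
rewrite len_code_nat; case: (len x) => [|[|[|[|[|n]]]]] //=.
- by case E : (is_expr y) => // _; have /is_exprP[e ->] := E; exists (Assign e).
- case E : (_ && _) => // _; case/andP: E => /Hhy [a ha] /Hty [b hb].
  exists (Seq a b); rewrite /= -ha -hb.
  by case: (y) ha => //=; case: (a).
- case E : (_ && _) => // _; case/andP: E => /is_exprP [a ha] /Hty [b hb].
  exists (While a b); rewrite /= -ha -hb.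
  by case: (y) ha => //=; case: (a).
- by case: (y) => // _; exists Write.
- by case E : (is_expr y) => // _; have /is_exprP[e ->] := E; exists (Ask e).
Qed.

Lemma comp_is_prog O {A} {tA : type0 A} (T : A -> tree) :
  computable O T -> computable O (fun a => is_prog (T a)).
Proof.
move=> hT; apply: comp_negb; apply: comp_is_nil.
by apply: (comp_treerec (p := id) (G := fun _ => is_prog_rec) _ _ hT);
   rewrite /is_prog_rec; comp.
Qed.
Ltac comp_rule_prog :=
  match goal with
  | |- computable _ (fun a => is_prog (@?T a)) =>
      refine (comp_is_prog (T := T) _); comp
  | _ => comp_rule_expr
  end.

Ltac comp_rule ::= comp_rule_prog.

(** The oracle [q] of the simulated program is a parameter: the interpreter will also run programs
    with recursive approximations of the halting problem. *)
Definition step_tree (q : tree -> bool) (S : tree) : tree :=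
  let K := hd S in let d := hd (tl S) in let w := tl (tl S) in
  let tag := len (hd (hd K)) in let arg := tl (hd K) in
  let ret k d := Cons k (Cons d w) in
  if is_nil K then S
  else if tag == 0 then ret (tl K) (treerec (eval_rec d) arg)
  else if tag == 1 then ret (Cons (hd arg) (Cons (tl arg) (tl K))) d
  else if tag == 2 then
    if is_nil (treerec (eval_rec d) (hd arg)) then ret (tl K) d
    else ret (Cons (tl arg) K) d
  else if tag == 3 then Cons (tl K) (Cons d (Cons Nil w))
  else ret (tl K) (Cons (code (q (treerec (eval_rec d) arg))) d).

Lemma step_treeE q s : step_tree q (code s) = code (step q s).
Proof.
case: s => [[|[e|a b|e a||e] k] d w] //=; rewrite /step_tree /= ?treerec_eval //.
by case: (eval e d).
Qed.

Lemma comp_step_tree O {A} {tA : type0 A} (q : A -> tree -> bool) (S : A -> tree) :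
  computable O (fun z : A * tree => q z.1 z.2) -> computable O S ->
  computable O (fun a => step_tree (q a) (S a)).
Proof.
move=> hq hS.
have hq' : computable O (fun a => q a (treerec (eval_rec (hd (tl (S a))))
    (tl (hd (hd (S a)))))).
  by apply: (comp2 hq); comp.
by rewrite /step_tree; comp.
Qed.

(* Programs given as trees, possibly not the code of a program. *)
Definition run_tree (q : tree -> bool) (c d : tree) (t : nat) : tree :=
  iter t (step_tree q) (Cons (Cons c Nil) (Cons d Nil)).

Lemma run_treeE q c d t : run_tree q (code_prog c) d t = code (run q c d t).
Proof.
rewrite /run_tree /run; elim: t => [//|t IH].
by rewrite !iterS IH step_treeE.
Qed.

Lemma comp_run_tree O {A} {tA : type0 A} (q : A -> tree -> bool)
    (c d : A -> tree) (t : A -> nat) :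
  computable O (fun z : A * tree => q z.1 z.2) -> computable O c ->
  computable O d -> computable O t ->
  computable O (fun a => run_tree (q a) (c a) (d a) (t a)).
Proof.
move=> hq hc hd ht; apply: comp_iter => //; last comp.
apply: comp_step_tree; last comp.
by apply: (comp2 hq); comp.
Qed.

Lemma comp_run O {A} {tA : type0 A} (q : A -> tree -> bool) (c : A -> prog)
    (d : A -> tree) (t : A -> nat) :
  computable O (fun z : A * tree => q z.1 z.2) -> computable O c ->
  computable O d -> computable O t ->
  computable O (fun a => run (q a) (c a) (d a) (t a)).
Proof.
move=> hq hc hd ht; apply: comp_via (comp_run_tree hq (comp_code hc) hd ht) => a.
exact: run_treeE.
Qed.

Lemma comp_written O {A} {tA : type0 A} (s : A -> config) :
  computable O s -> computable O (fun a => written (s a)).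
Proof. by move=> h; apply: comp_via (comp_tl (comp_tl (comp_code h))). Qed.

Lemma comp_store O {A} {tA : type0 A} (s : A -> config) :
  computable O s -> computable O (fun a => store (s a)).
Proof. by move=> h; apply: comp_via (comp_hd (comp_tl (comp_code h))). Qed.

Definition halted (s : config) : bool := if todo s is [::] then true else false.

Lemma comp_halted O {A} {tA : type0 A} (s : A -> config) :
  computable O s -> computable O (fun a => halted (s a)).
Proof.
move=> h; apply: comp_ext (comp_is_nil (comp_hd (comp_code h))) => a.
by rewrite /halted /=; case: (todo _).
Qed.

Definition output_at (q : pred tree) (c : prog) (d : tree) (t : nat) : option nat :=
  let s := run q c d t in
  if halted s && is_nat (store s) then Some (len (store s)) else None.

Lemma comp_output_at O {A} {tA : type0 A} (q : A -> tree -> bool) (c : A -> prog)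
    (d : A -> tree) (t : A -> nat) :
  computable O (fun z : A * tree => q z.1 z.2) -> computable O c ->
  computable O d -> computable O t ->
  computable O (fun a => output_at (q a) (c a) (d a) (t a)).
Proof. by move=> hq hc hd ht; rewrite /output_at;
have h := comp_run hq hc hd ht; have h1 := comp_halted h;
have h2 := comp_store h; comp. Qed.

Lemma output_atP q c d t y : output_at q c d t = Some y <->
  halts_in q c d t /\ store (run q c d t) = code y.
Proof.
rewrite /output_at /halted /halts_in; split.
  by case: (todo _) => //=; case: is_natP => // -> [<-]; rewrite len_code_nat.
case=> -> /= ->; rewrite len_code_nat.
by case: is_natP => //; rewrite len_code_nat.
Qed.

Ltac comp_rule_run :=
  match goal with
  | |- computable _ (fun a => written (@?s a)) =>
      refine (comp_written (s := s) _); comp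
  | |- computable _ (fun a => store (@?s a)) =>
      refine (comp_store (s := s) _); comp
  | |- computable _ (fun a => halted (@?s a)) =>
      refine (comp_halted (s := s) _); comp
  | |- computable _ (fun a => run_tree _ (@?c a) (@?d a) (@?t a)) =>
      refine (comp_run_tree (c := c) (d := d) (t := t) _ _ _ _); comp
  | |- computable _ (fun a => run _ (@?c a) (@?d a) (@?t a)) =>
      refine (comp_run (c := c) (d := d) (t := t) _ _ _ _); comp
  | |- computable _ (fun a => output_at _ (@?c a) (@?d a) (@?t a)) =>
      refine (comp_output_at (c := c) (d := d) (t := t) _ _ _ _); comp
  | |- computable _ (fun a => no_oracle _) =>
      exact: (comp_const _ false)
  | |- computable ?O (fun a => ?O (@?f a)) => refine (comp_ask (f := f) _); comp
  | _ => comp_rule_prog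
  end.

Ltac comp_rule ::= comp_rule_run.

(** * Searches and limits *)

Definition eventually (P : nat -> Prop) : Prop :=
  exists s0, forall s, s0 <= s -> P s.

Lemma eventually_and P Q :
  eventually P -> eventually Q -> eventually (fun s => P s /\ Q s).
Proof.
by move=> [i hi] [j hj]; exists (maxn i j) => s; rewrite geq_max => /andP[/hi ? /hj].
Qed.

Lemma eventually_mono (P Q : nat -> Prop) :
  (forall s, P s -> Q s) -> eventually P -> eventually Q.
Proof. by move=> h [i hi]; exists i => s /hi /h. Qed.

Lemma eventually_ge m : eventually (fun s => m <= s).
Proof. by exists m. Qed.

Lemma eventually_all (T : eqType) (l : seq T) (P : T -> nat -> Prop) :
  (forall x, x \in l -> eventually (P x)) ->
  eventually (fun s => forall x, x \in l -> P x s).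
Proof.
elim: l => [|x l IH] h; first by exists 0.
have hx := h _ (mem_head _ _).
have hl : eventually (fun s => forall y, y \in l -> P y s).
  by apply: IH => y hy; apply: h; rewrite inE hy orbT.
apply: eventually_mono (eventually_and hx hl) => s [h1 h2] y.
by rewrite inE => /predU1P[->|/h2].
Qed.

Lemma eventually_unique (T : Type) (f : nat -> T) x y :
  eventually (fun s => f s = x) -> eventually (fun s => f s = y) -> x = y.
Proof.
move=> hx hy; have [s h] := eventually_and hx hy.
by have [<- <-] := h s (leqnn s).
Qed.

Lemma iter_halted O t s : todo s = [::] -> iter t (step O) s = s.
Proof.
move=> h; elim: t => //= t ->; by case: s h => k d w /= ->.
Qed.

Lemma run_halted O c d t t' :
  halts_in O c d t -> t <= t' -> run O c d t' = run O c d t.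
Proof. by move=> h /subnK <-; rewrite /run iterD iter_halted. Qed.

Lemma halts_in_store O c d t t' :
  halts_in O c d t -> halts_in O c d t' -> run O c d t = run O c d t'.
Proof.
move=> h h'; case: (leqP t t') => [|/ltnW] le; last exact: run_halted.
by rewrite (run_halted h le).
Qed.

Lemma computes_run O c d d' :
  computes O c d d' -> exists t, run O c d t = Config [::] d' 0.
Proof. by move=> h; apply: (h [::] 0). Qed.

Lemma output_at_mono q c d t t' y :
  output_at q c d t = Some y -> t <= t' -> output_at q c d t' = Some y.
Proof.
by move=> /output_atP [h e] le; apply/output_atP; rewrite /halts_in !(run_halted h le).
Qed.

Lemma output_at_unique q c d t t' y y' :
  output_at q c d t = Some y -> output_at q c d t' = Some y' -> y = y'.
Proof.
case: (leqP t t') => [|/ltnW] le h h'.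
  by have := output_at_mono h le; rewrite h' => -[].
by have := output_at_mono h' le; rewrite h => -[].
Qed.

Lemma phi_relP {X} {tX : type0 X} q c (x : X) (y : nat) :
  phi_rel q c x y <-> exists t, output_at q c (code x) t = Some y.
Proof. by split=> -[t h]; exists t; apply/output_atP. Qed.

Lemma phi_rel_functional {X Y} {tX : type0 X} {tY : type0 Y} q c (x : X) (y y' : Y) :
  phi_rel q c x y -> phi_rel q c x y' -> y = y'.
Proof.
move=> [t [h e]] [t' [h' e']]; apply: code_inj.
by rewrite -e -e' (halts_in_store h h').
Qed.

(** Passing between two distinct configurations takes at least one step. This is how loops are shown
    to go on forever. *)
Lemma reach_sequence O s0 (h : nat -> config) :
  reach O s0 (h 0) -> (forall i, reach O (h i) (h i.+1)) ->
  (forall i, h i <> h i.+1) ->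
  forall i, exists2 t, i <= t & iter t (step O) s0 = h i.
Proof.
move=> [t0 h0] hs hne; elim=> [|i [t le e]]; first by exists t0.
have [[|t'] e'] := hs i; first by case: (hne i).
by exists (t'.+1 + t); [rewrite addSn ltnS; lia|rewrite iterD e].
Qed.

(** Unbounded search: a loop tries the stages in turn, its flag being cleared at the first
    success. *)
Lemma mu O {A Y} {tA : type0 A} {tY : type0 Y} (g : A -> nat -> option Y) :
  computable O (fun z : A * nat => g z.1 z.2) ->
  exists c,
    (forall a s y, g a s = Some y -> (forall s', s' < s -> g a s' = None) ->
       computes O c (code a) (code y)) /\
    (forall a, (forall s, g a s = None) -> forall t, ~ halts_in O c (code a) t).
Proof.
move=> hg.
have [c0 h0] : computable O (fun a : A => (true, (a, 0))) by comp.
pose next (z : bool * (A * nat)) := (~~ isSome (g z.2.1 z.2.2), (z.2.1, z.2.2.+1)).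
have [cb hb] : computable O next.
  apply: comp_pair; last comp.
  by apply: comp_negb; apply: comp_isSome; apply: (comp2 hg); comp.
(* The loop increments the stage even when it succeeds, hence the predecessor. *)
have [c1 h1] : computable O (fun z : bool * (A * nat) =>
    if g z.2.1 z.2.2.-1 is Some y then code y else Nil).
  by apply: (comp_option_case (F := fun _ => code)); [apply: (comp2 hg)| |]; comp.
pose loop := While (EHd Var) cb.
pose c := Seq c0 (Seq loop c1).
have hstart (a : A) k w : reach O (Config (c :: k) (code a) w)
    (Config [:: loop, c1 & k] (code (true, (a, 0))) w).
  rewrite /c; apply: reach_step => /=; apply: reach_trans (h0 a _ _) _.
  exact: reach_step1.
have hnext a s k w : g a s = None ->
  reach O (Config [:: loop, c1 & k] (code (true, (a, s))) w)
          (Config [:: loop, c1 & k] (code (true, (a, s.+1))) w).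
  move=> e; apply: reach_while_go => //.
  by have := hb (true, (a, s)); rewrite /next /= e.
exists c; split.
  move=> a s y e hlt k w; apply: reach_trans (hstart a k w) _.
  apply: (@reach_trans _ (Config [:: loop, c1 & k] (code (true, (a, s))) w)).
    elim: s hlt {e} => [|s IH] hlt; first exact: reach_refl.
    apply: reach_trans (hnext _ _ _ _ (hlt s _)) => //.
    by apply: IH => s' lt; apply: hlt; apply: ltnW.
  have h2 := hb (true, (a, s)); rewrite /next /= e in h2.
  apply: reach_trans (reach_while_go _ _ _ h2) _ => //.
  apply: reach_trans (reach_while_stop _ _ _ _ _) _ => //.
  by have := h1 (false, (a, s.+1)); rewrite /= e; apply.
move=> a hN t ht.
(* After a halt at time [t] the configuration would never change, but the loop is still pending at
   some time after [t]. *)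
have [] := @reach_sequence O (Config [:: c] (code a) 0)
  (fun i => Config [:: loop; c1] (code (true, (a, i))) 0) _ _ _ t.
- exact: hstart.
- by move=> i; apply: hnext.
- by move=> i [] /(@code_nat_inj i i.+1) /n_Sn.
move=> t' le e; have := run_halted ht le; rewrite /run e => e'.
by move: ht; rewrite /halts_in /run -e'.
Qed.

(** It does not matter which successful stage comes first: every value found is correct, and [f] has
    at most one value at each point. *)
Lemma pr_search {X Y} {tX : type0 X} {tY : type0 Y} (f : pfun X Y)
    (g : X -> nat -> option Y) :
  computable no_oracle (fun z : X * nat => g z.1 z.2) ->
  (forall x s y, g x s = Some y -> f x y) ->
  (forall x y, f x y -> exists s, g x s <> None) ->
  (forall x y y', f x y -> f x y' -> y = y') ->
  partial_recursive f.
Proof.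
move=> hg gf fg ff; have [c [hc hN]] := mu hg; exists c.
apply/funext => x; apply/funext => y; apply/propext.
have least : (exists s, g x s <> None) ->
    exists s y0, g x s = Some y0 /\ forall s', s' < s -> g x s' = None.
  move=> [s hs]; have ex : exists s, isSome (g x s) by exists s; case: (g x s) hs.
  case: (ex_minnP ex) => m; case E: (g x m) => [y0|] // _ hm.
  exists m, y0; split=> // s' lt; case E': (g x s') => [z|] //.
  by have := hm s'; rewrite E' => /(_ isT); lia.
split.
  move=> fxy; have [s [y0 [e /(hc _ _ _ e) h]]] := least (fg _ _ fxy).
  have [t ht] := computes_run h; exists t.
  by rewrite /outputs_in /halts_in ht (ff _ _ _ fxy (gf _ _ _ e)).
move=> [t [ht et]]; case: (pselect (exists s, g x s <> None)); last first.
  move=> hne; case: (hN x _ t ht) => s; case E: (g x s) => [z|] //.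
  by case: hne; exists s; rewrite E.
move=> /least [s [y0 [e /(hc _ _ _ e) h]]]; have [t' ht'] := computes_run h.
have e' : run no_oracle c (code x) t = Config [::] (code y0) 0.
  by rewrite (halts_in_store ht (t' := t')) // /halts_in ht'.
by move: et; rewrite e' /= => /(@code_inj Y tY) <-; apply: gf e.
Qed.

(** Recursively enumerable sets as domains; the value [0] carries no information. *)
Lemma pr_semidecidable {X} {tX : type0 X} (P : X -> nat -> bool) :
  computable no_oracle (fun z : X * nat => P z.1 z.2) ->
  partial_recursive (fun x y => y = 0 /\ exists s, P x s).
Proof.
move=> hP; apply: (pr_search (g := fun x s => if P x s then Some 0 else None)).
- by comp.
- by move=> x s y; case E: (P x s) => // -[<-]; split=> //; exists s.
- by move=> x y [_ [s hs]]; exists s; rewrite hs.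
- by move=> x y y' [-> _] [-> _].
Qed.

Lemma pr_total {X Y} {tX : type0 X} {tY : type0 Y} (f : X -> Y) :
  computable no_oracle f -> partial_recursive (fun x y => y = f x).
Proof.
move=> hf; apply: (pr_search (g := fun x _ => Some (f x))).
- by apply: comp_Some; apply: comp_comp hf _; comp.
- by move=> x s y [].
- by move=> x y _; exists 0.
- by move=> x y y' -> ->.
Qed.

(** * Unary output *)

Lemma written_step O s : written s <= written (step O s).
Proof. by case: s => [[|[e|a b|e a||e] k] d w] //=; case: (eval e d). Qed.

Lemma written_mono O c d t t' :
  t <= t' -> written (run O c d t) <= written (run O c d t').
Proof.
move=> /subnK <-; elim: (t' - t) => // n IH.
by rewrite addSn /run iterS; apply: leq_trans IH (written_step _ _).
Qed.

(** At stage [s] one symbol is written if fewer than [a x s] have been. The bound prevents writing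
    too many symbols, and once the stages equal [n] the count catches up. The stages need not be
    monotone. *)
Lemma write_up_to O {A} {tA : type0 A} (a : A -> nat -> nat) :
  computable O (fun z : A * nat => a z.1 z.2) ->
  exists v, forall x n, (forall s, a x s <= n) -> eventually (fun s => a x s = n) ->
    exists t0, forall t, t0 <= t -> written (run O v (code x) t) = n.
Proof.
move=> ha.
have [c0 h0] : computable O (fun x : A => (x, (0, 0))) by comp.
pose next (z : A * (nat * nat)) :=
  let b := z.2.2 < a z.1 z.2.1 in (b, (z.1, (z.2.1.+1, if b then z.2.2.+1 else z.2.2))).
have [c1 h1] : computable O next.
  have h : computable O (fun z : A * (nat * nat) => z.2.2 < a z.1 z.2.1).
    by apply: comp_leq; [|apply: (comp2 ha)]; comp.
  by rewrite /next; comp.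
pose wr := While (EHd Var) (Seq Write (Assign (ECons ENil (ETl Var)))).
pose loop := While (quote (code_bool true)) (Seq c1 (Seq wr (Assign (ETl Var)))).
pose v := Seq c0 loop.
exists v => x n le ev.
(* The number of symbols written before stage [i], which the program also keeps in its store. *)
pose w i := iteri i (fun s m => if m < a x s then m.+1 else m) 0.
pose h i := Config [:: loop]
  (Cons (@code A tA x) (Cons (code_nat i) (code_nat (w i)))) (w i).
have hw i : w i <= n.
  elim: i => //= i IH; case: ltnP => // lt; exact: leq_trans lt (le i).
have heads : forall i, exists2 t, i <= t &
    iter t (step O) (Config [:: v] (code x) 0) = h i.
  apply: reach_sequence.
  - by apply: reach_step => /=; apply: reach_trans (h0 x _ _) _; apply: reach_refl.
  - move=> i; rewrite /h; apply: reach_step => /=; apply: reach_step => /=.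
    apply: reach_trans (h1 (x, (i, w i)) _ _) _; rewrite /next /=.
    apply: reach_step => /=; case: ifP => _ /=.
    + do 5 (apply: reach_step => /=).
      by apply: reach_step => /=; apply: reach_refl.
    + by do 2 (apply: reach_step => /=); apply: reach_refl.
  - by move=> i [] /(@code_nat_inj i i.+1) /n_Sn.
have bound t : written (run O v (code x) t) <= n.
  have [t' le' e] := heads t.
  by apply: leq_trans (written_mono _ _ _ le') _; rewrite /run e; apply: hw.
have [s0 hs0] := ev.
(* From stage [s0] on, each stage writes a symbol until there are [n] of them. *)
have grow i : minn n i <= w (s0 + i).
  elim: i => [|i IH]; first by rewrite minn0.
  rewrite addnS /= -/(w (s0 + i)) hs0 ?leq_addr //.
  by case: ltnP => h'; move: IH (hw (s0 + i)); lia.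
have [t0 le0 e0] := heads (s0 + n); exists t0 => t let0.
apply/eqP; rewrite eqn_leq bound /=.
apply: leq_trans (written_mono _ _ _ let0); rewrite /run e0 /=.
by have := grow n; rewrite minnn.
Qed.

(** The code of [n] is a chain of [n] conses, which a loop consumes while writing one symbol for
    each. *)
Lemma write_result O c : exists v, forall x n,
  computes O c (code (x : word)) (code (n : nat)) -> infinite_sem O v x n.
Proof.
exists (Seq c (While Var (Seq Write (Assign (ETl Var))))) => x n h.
set v := Seq _ _.
have [t0 ht0] : reach O (Config [:: v] (code x) 0) (Config [::] Nil n).
  apply: reach_step => /=; apply: reach_trans (h _ _) _ => /=.
  rewrite -{2}(addn0 n); elim: n 0 {h} => [|n IH] m /=.
    by apply: reach_step1.
  do 4 (apply: reach_step => /=); rewrite addSnnS; exact: IH.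
exists t0 => t le; rewrite (@run_halted _ _ _ t0) ?/halts_in /run ?ht0 //.
Qed.

(** * Limits and the halting problem *)

(** One half of the Shoenfield limit lemma: whether the sequence still changes after stage [s] is a
    halting question, so the oracle finds the first stage after which it is constant. *)
Lemma limit_lemma {A} {tA : type0 A} (b : A -> nat -> nat) :
  (forall O, computable O (fun z : A * nat => b z.1 z.2)) ->
  exists c, forall a m, eventually (fun s => b a s = m) ->
    computes zero_jump c (code a) (code m).
Proof.
move=> hb.
pose g (z : A * nat) i := if b z.1 (z.2 + i) != b z.1 z.2 then Some 0 else None.
have hg : computable no_oracle (fun z : A * nat * nat => g z.1 z.2).
  rewrite /g; apply: comp_if; [|comp|comp]; apply: comp_negb; apply: comp_eqn.
    by apply: (comp2 (hb _)); comp.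
  by apply: (comp2 (hb _)); comp.
have [c0 [hc0 hN0]] := mu hg.
have changes z : zero_jump (Cons (code_prog c0) (code z)) <->
    exists i, b z.1 (z.2 + i) <> b z.1 z.2.
  split.
    move=> /asboolP [c [x [[/code_prog_inj <- <-] [t ht]]]].
    apply: contrapT => hne; apply: (hN0 z _ t ht) => i; rewrite /g.
    by case: eqP => // h; case: hne; exists i.
  move=> [i hi]; apply/asboolP; exists c0, (code z); split=> //.
  have ex : exists i, b z.1 (z.2 + i) != b z.1 z.2 by exists i; apply/eqP.
  case: (ex_minnP ex) => m hm hlt.
  have [] := @computes_run no_oracle c0 (code z) (code 0).
    apply: (hc0 _ m); first by rewrite /g hm.
    move=> s lt; rewrite /g; case: ifP => // /hlt; lia.
  by move=> t ht; exists t; rewrite /halts_in ht.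
pose q a s := zero_jump
  (Cons (code_prog c0) (@code _ (type0_prod tA type0_nat) (a, s))).
pose g' a s := if q a s then None
  else Some (b a s).
have hg' : computable zero_jump (fun z : A * nat => g' z.1 z.2).
  by have := hb zero_jump; rewrite /g' /q => hz; comp.
have [c [hc _]] := mu hg'; exists c => a m [s0 hs0].
have ex : exists s, ~~ q a s.
  exists s0; apply/negP => /(changes (a, s0)) [i] /=.
  by rewrite !hs0 ?leq_addr.
case: (ex_minnP ex) => s hs hlt; apply: (hc a s).
  rewrite /g' (negbTE hs); congr Some.
  have same i : b a (s + i) = b a s.
    by apply: contrapT => hi; move/negP: hs; apply; apply/(changes (a, s)); exists i.
  by rewrite -(same s0) hs0 // leq_addl.
by move=> s' lt; rewrite /g'; case: ifP => // /negbT /hlt; lia.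
Qed.

Lemma comp_limit {A} {tA : type0 A} (b : A -> nat -> nat) (l : A -> nat) :
  (forall O, computable O (fun z : A * nat => b z.1 z.2)) ->
  (forall a, eventually (fun s => b a s = l a)) -> computable zero_jump l.
Proof.
by move=> hb hl; have [c hc] := limit_lemma hb; exists c => a; apply: hc.
Qed.

(** Recursive approximations of [zero_jump]: halting within [s] steps. The syntax is tested because
    [run_tree] accepts any tree as a program. *)
Definition jump_at (s : nat) (d : tree) : bool :=
  is_prog (hd d) && is_nil (hd (run_tree no_oracle (hd d) (tl d) s)).

Lemma comp_jump_at O : computable O (fun z : nat * tree => jump_at z.1 z.2).
Proof.
rewrite /jump_at; apply: comp_andb; [comp|apply: comp_is_nil; apply: comp_hd].
by apply: (comp_run_tree (q := fun _ => no_oracle)); comp.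
Qed.

Lemma jump_at_limit d : eventually (fun s => jump_at s d = zero_jump d).
Proof.
have nilE x y s : is_nil (hd (run_tree no_oracle (code_prog x) y s)) <->
    halts_in no_oracle x y s.
  by rewrite run_treeE /= /halts_in; case: (todo _).
case E: (zero_jump d).
  have /asboolP [c [x [-> [t ht]]]] := E; exists t => s le; rewrite /jump_at /=.
  have -> : is_prog (code_prog c) by apply/is_progP; exists c.
  by apply/nilE; rewrite /halts_in (run_halted ht le).
exists 0 => s _; apply/negP => /andP[/is_progP [c hc]]; rewrite hc => /nilE h.
move/asboolP: E; apply; exists c, (tl d); split; last by exists s.
by rewrite -hc; case: (d) hc => //; case: (c).
Qed.

(** A run of [T] steps asks finitely many questions, on which the approximations are eventually
    right. *)
Lemma run_jump_at_limit c d T :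
  eventually (fun s => run (jump_at s) c d T = run zero_jump c d T).
Proof.
elim: T => [|T IH]; first by exists 0.
rewrite /run iterS -/(run zero_jump c d T).
case E: (run zero_jump c d T) => [k d' w].
have h2 : eventually (fun s => step (jump_at s) (Config k d' w)
    = step zero_jump (Config k d' w)).
  case: k E => [|[e|a b|e a||e] k] _; try by exists 0.
  by apply: eventually_mono (jump_at_limit (eval e d')) => s /= ->.
apply: eventually_mono (eventually_and IH h2) => s [h h'].
by rewrite iterS -/(run (jump_at s) c d T) h E h'.
Qed.

Lemma output_jump_at_limit c d y : (exists t, output_at zero_jump c d t = Some y) ->
  eventually (fun s => output_at (jump_at s) c d s = Some y).
Proof.
move=> [T /output_atP [hT eT]]; have [s0 hs0] := run_jump_at_limit c d T.
(* The run is unchanged after it halts, so the stage can also serve as the time bound. *)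
exists (maxn s0 T) => s; rewrite geq_max => /andP[/hs0 e le].
apply: output_at_mono le; apply/output_atP; rewrite /halts_in e; exact: conj hT eT.
Qed.

(** * Reductions between complexities *)

(** Here [A n] and [B n] stand for the sets of descriptions of [n] in two senses. *)
Definition reduces (A B : nat -> set word) : Prop :=
  exists c, forall n p, A n p -> exists2 q, B n q & size q <= size p + c.

Lemma reduces_trans B A C : reduces A B -> reduces B C -> reduces A C.
Proof.
move=> [c hc] [c' hc']; exists (c + c') => n p /hc [q /hc' [r Cr le'] le].
by exists r => //; lia.
Qed.

Lemma min_length_le (A : set word) p : A p -> min_length A <= size p.
Proof.
rewrite /min_length => Ap; case: xgetP => [k _ [_ h]|//]; exact: h.
Qed.

Lemma min_length_attained (A : set word) :
  A !=set0 -> exists2 p, A p & size p = min_length A.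
Proof.
move=> [p0 Ap0].
have ex : exists k, `[< exists2 p, A p & size p = k >].
  by exists (size p0); apply/asboolP; exists p0.
case: (ex_minnP ex) => k /asboolP [p Ap sp] hk.
have : (exists2 q, A q & size q = k) /\ forall q, A q -> k <= size q.
  by split; [exists p|move=> q Aq; apply: hk; apply/asboolP; exists q].
by move=> hP; rewrite /min_length; case: xgetP => [m _ []|/(_ k)].
Qed.

(** Descriptions must exist on the side of [A], because [min_length] is [0] on the empty set. *)
Lemma reduces_le_ct A B : (forall n, A n !=set0) -> reduces A B ->
  le_ct (fun n => min_length (B n)) (fun n => min_length (A n)).
Proof.
move=> hA [c hc]; exists c => n; have [p Ap <-] := min_length_attained (hA n).
have [q Bq le] := hc _ _ Ap; exact: leq_trans (min_length_le Bq) le.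
Qed.

Lemma reduces_nonempty A B n : A n !=set0 -> reduces A B -> B n !=set0.
Proof. by move=> [p Ap] [c /(_ _ _ Ap) [q Bq _]]; exists q. Qed.

Lemma optimal_reduces sem u v : optimal sem u ->
  reduces (fun n => [set p | sem v p n]) (fun n => [set p | sem u p n]).
Proof. by move=> /(_ v) [c hc]; exists c => n p /hc. Qed.

Lemma universal_reduces E C (U V : word -> E) (rho : E -> nat -> Prop) :
  strongly_universal C U -> C V ->
  reduces (fun n => [set p | rho (V p) n]) (fun n => [set p | rho (U p) n]).
Proof.
move=> [_ hU] /hU [e ->].
(* The constant is the length of the prefix coding [e], with its closing bit. *)
exists (size (flatten [seq [:: false; b] | b <- e])).+1 => n p /= h.
by exists (pair_word e p) => //; rewrite /pair_word size_cat /=; lia.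
Qed.

Lemma le_ct_trans g f h : le_ct f g -> le_ct g h -> le_ct f h.
Proof. by move=> [c hc] [d hd]; exists (d + c) => n; move: (hc n) (hd n); lia. Qed.

(** With a bound [j] against [2 * j] the difference is about [j], which outgrows all the constants
    together; [f'] and [g'] stand in for [f] and [g] up to such constants. *)
Lemma lt_ct_gap f g f' g' : le_ct f g -> le_ct f f' -> le_ct g' g ->
  (exists c, forall j, exists n, f' n <= j + c /\ 2 * j < g' n) -> lt_ct f g.
Proof.
move=> fg [c1 h1] [c2 h2] [c0 h0]; split=> // c.
have [n [hf hg]] := h0 (c0 + c1 + c2 + c); exists n.
by move: (h1 n) (h2 n); lia.
Qed.

Lemma computes_halting_sem O c (p : word) (n : nat) :
  computes O c (code p) (code n) -> halting_sem O c p n.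
Proof.
by move=> /computes_run [t ht]; exists t; rewrite /outputs_in /halts_in ht.
Qed.

Lemma halting_nonempty O u : optimal (halting_sem O) u ->
  forall n, [set p | halting_sem O u p n] !=set0.
Proof.
move=> hu n; have [v hv] : computable O (fun p : word => size p) by comp.
apply: reduces_nonempty (optimal_reduces v hu); exists (nseq n true).
by have := computes_halting_sem (hv (nseq n true)); rewrite size_nseq.
Qed.

Lemma infinite_nonempty O u : optimal (infinite_sem O) u ->
  forall n, [set p | infinite_sem O u p n] !=set0.
Proof.
move=> hu n; have [c hc] : computable O (fun p : word => size p) by comp.
have [v hv] := write_result O c.
apply: reduces_nonempty (optimal_reduces v hu); exists (nseq n true) => /=.
by apply: hv; have := hc (nseq n true); rewrite size_nseq.
Qed.

(** * Counting domains *)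

Lemma card_II_seq (A : set nat) n : A #= `I_n ->
  exists l, [/\ uniq l, size l = n & forall x, A x <-> x \in l].
Proof.
rewrite card_eq_sym => /card_set_bijP [f [fS fI fsurj]].
exists (map f (iota 0 n)); split.
- rewrite map_inj_in_uniq ?iota_uniq // => i j.
  rewrite !mem_iota add0n /= => hi hj; apply: fI; exact/mem_set.
- by rewrite size_map size_iota.
- move=> x; split.
    move=> /fsurj [i /= lt <-]; apply: map_f; by rewrite mem_iota.
  by move=> /mapP [i]; rewrite mem_iota /= add0n => lt ->; apply: fS.
Qed.

Definition count_at (P : nat -> bool) (s : nat) : nat :=
  size [seq x <- iota 0 s | P x].

(** The approximations accept only elements of [A], so the count is at most [n]; it is [n] as soon
    as all the elements have been accepted and lie below the stage. *)
Lemma count_at_limit (A : set nat) n (P : nat -> nat -> bool) :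
  A #= `I_n -> (forall s x, P s x -> A x) ->
  (forall x, A x -> eventually (fun s => P s x)) ->
  (forall s, count_at (P s) s <= n) /\ eventually (fun s => count_at (P s) s = n).
Proof.
move=> /card_II_seq [l [ul <- hl]] hPA hAP.
have le s : count_at (P s) s <= size l.
  apply: uniq_leq_size; first by rewrite filter_uniq // iota_uniq.
  by move=> x; rewrite mem_filter => /andP [/hPA /hl].
split=> //.
have : eventually (fun s => forall x, x \in l -> P s x /\ x < s).
  apply: eventually_all => x /hl /hAP h.
  exact: eventually_and h (eventually_ge x.+1).
apply: eventually_mono => s h; apply/eqP; rewrite eqn_leq le /=.
apply: uniq_leq_size => // x /h [hP lt].
by rewrite mem_filter hP mem_iota.
Qed.

Lemma comp_count_at O {A} {tA : type0 A} (P : A -> nat -> bool) (s : A -> nat) :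
  computable O (fun z : A * nat => P z.1 z.2) -> computable O s ->
  computable O (fun a => count_at (P a) (s a)).
Proof. by move=> hP hs; rewrite /count_at; comp. Qed.

Definition dom_count (c : prog) (p : word) (s : nat) : nat :=
  count_at (fun x => isSome (output_at no_oracle c (code (p, x)) s)) s.

Lemma comp_dom_count O c : computable O (fun z : word * nat => dom_count c z.1 z.2).
Proof.
apply: (comp_count_at (P := fun z x =>
  isSome (output_at no_oracle c (code (z.1, x)) z.2))); comp.
Qed.

Lemma dom_count_limit c (f : pfun nat nat) (p : word) n :
  (forall x y, f x y <-> phi c (p, x) y) -> card_N f n ->
  (forall s, dom_count c p s <= n) /\ eventually (fun s => dom_count c p s = n).
Proof.
move=> hf /count_at_limit h.
apply: (h (fun s x => isSome (output_at no_oracle c (code (p, x)) s))).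
  move=> s x; case E: output_at => [y|] // _; exists y.
  by apply/hf; apply/phi_relP; exists s.
move=> x [y /hf /phi_relP [t ht]]; exists t => s le.
by rewrite (output_at_mono ht le).
Qed.

Lemma PR_family_prog (X : Type) (tX : type0 X) (U : word -> pfun X nat) :
  PR_family U -> exists c, forall p x y, U p x y <-> phi c (p, x) y.
Proof.
move=> [c hc]; exists c => p x y.
by have := congr1 (fun f => f (p, x) y) hc => /= ->.
Qed.

(** When the stages have a maximum [n], the domain is the initial segment of length [n]. *)
Definition below_stages (a : word -> nat -> nat) (p : word) : pfun nat nat :=
  fun x y => y = 0 /\ exists s, x < a p s.

Lemma PR_family_below_stages (a : word -> nat -> nat) :
  computable no_oracle (fun z : word * nat => a z.1 z.2) ->
  PR_family (below_stages a).
Proof.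
move=> ha; apply: (pr_semidecidable (P := fun px s => px.2 < a px.1 s)); comp.
Qed.

Lemma card_below_stages a p n : (forall s, a p s <= n) ->
  eventually (fun s => a p s = n) -> card_N (below_stages a p) n.
Proof.
move=> le [s hs]; rewrite /card_N.
suff -> : dom (below_stages a p) = `I_n by [].
apply/seteqP; split=> x /=.
  by move=> [y [_ [s' lt]]]; apply: leq_trans lt (le s').
by move=> lt; exists 0; split=> //; exists s; rewrite hs.
Qed.

Lemma halting_reduces_card_N u UcardN :
  strongly_universal (@PR_family nat nat _ _) UcardN ->
  reduces (fun n => [set p | halting_sem no_oracle u p n])
          (fun n => [set p | card_N (UcardN p) n]).
Proof.
move=> hU.
(* The stages are [0] until the program halts with a number, and then equal its output. *)
pose a (p : word) s :=
  if output_at no_oracle u (@code word type0_word p) s is Some y then y else 0.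
apply: reduces_trans _ (universal_reduces card_N hU (V := below_stages a) _).
  exists 0 => n p /phi_relP [t ht]; exists p; last by rewrite addn0.
  apply: card_below_stages.
    move=> s; rewrite /a; case E: output_at => [y|] //.
    by rewrite (output_at_unique E ht).
  by exists t => s le; rewrite /a (output_at_mono ht le).
by apply: PR_family_below_stages; rewrite /a; comp.
Qed.

Lemma infinite_reduces_card_N u UcardN :
  strongly_universal (@PR_family nat nat _ _) UcardN ->
  reduces (fun n => [set p | infinite_sem no_oracle u p n])
          (fun n => [set p | card_N (UcardN p) n]).
Proof.
move=> hU; pose a (p : word) s := written (run no_oracle u (@code word type0_word p) s).
apply: reduces_trans _ (universal_reduces card_N hU (V := below_stages a) _).
  exists 0 => n p [t ht]; exists p; last by rewrite addn0.
  apply: card_below_stages; last by exists t.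
  move=> s; rewrite -(ht (maxn s t)) ?leq_maxr //.
  by apply: written_mono; rewrite leq_maxl.
by apply: PR_family_below_stages; rewrite /a; comp.
Qed.

Lemma card_N_reduces_infinite UcardN u :
  PR_family UcardN -> optimal (infinite_sem no_oracle) u ->
  reduces (fun n => [set p | card_N (UcardN p) n])
          (fun n => [set p | infinite_sem no_oracle u p n]).
Proof.
move=> /PR_family_prog [c hc] hu.
have [v hv] := write_up_to (comp_dom_count no_oracle c).
apply: reduces_trans _ (optimal_reduces v hu).
exists 0 => n p /= /(dom_count_limit (hc p)) [h1 h2].
by exists p; [apply: hv|rewrite addn0].
Qed.

Lemma PR_family_empty : @PR_family nat nat _ _ (fun _ _ _ => False).
Proof.
apply: (pr_search (g := fun _ _ => None)) => //.
exact: comp_const.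
Qed.

Lemma card_N_reduces_card_Z UcardN UcardZ :
  PR_family UcardN -> strongly_universal (@PR2_family nat nat _ _) UcardZ ->
  reduces (fun n => [set p | card_N (UcardN p) n])
          (fun n => [set p | card_Z (UcardZ p) (Posz n)]).
Proof.
move=> hN hZ.
(* The cardinal [n] is the difference of [n] and the cardinal of an empty domain. *)
apply: reduces_trans _ (universal_reduces (fun fg n => card_Z fg (Posz n)) hZ
  (V := fun p => (UcardN p, fun _ _ => False)) _); last first.
  by split=> //; apply: PR_family_empty.
exists 0 => n p h; exists p; last by rewrite addn0.
exists n, 0; split=> //; last by rewrite GRing.subr0.
rewrite /card_N /dom /=; suff -> : [set x : nat | exists y : nat, False] = `I_0 by [].
by rewrite II0; apply/seteqP; split=> x // [].
Qed.

Lemma card_Z_limit UcardZ : PR2_family UcardZ ->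
  exists c, forall p n, card_Z (UcardZ p) (Posz n) ->
    computes zero_jump c (code p) (code n).
Proof.
move=> [/PR_family_prog [c1 h1] /PR_family_prog [c2 h2]].
(* Truncated subtraction is harmless: in the limit the difference is the natural number [n]. *)
have hb O : computable O
    (fun z : word * nat => dom_count c1 z.1 z.2 - dom_count c2 z.1 z.2).
  by apply: comp_subn; apply: comp_dom_count.
have [c hc] := limit_lemma (b := fun p s => dom_count c1 p s - dom_count c2 p s) hb.
exists c => p n [m [k [hm hk e]]]; apply: hc.
have [_ e1] := dom_count_limit (h1 p) hm.
have [_ e2] := dom_count_limit (h2 p) hk.
by apply: eventually_mono (eventually_and e1 e2) => s [-> ->]; lia.
Qed.

Lemma card_Z_reduces_halting UcardZ u :
  PR2_family UcardZ -> optimal (halting_sem zero_jump) u ->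
  reduces (fun n => [set p | card_Z (UcardZ p) (Posz n)])
          (fun n => [set p | halting_sem zero_jump u p n]).
Proof.
move=> /card_Z_limit [c hc] hu; apply: reduces_trans _ (optimal_reduces c hu).
exists 0 => n p /= /hc h; exists p; last by rewrite addn0.
exact: computes_halting_sem h.
Qed.

Lemma card_Z_reduces_infinite UcardZ u :
  PR2_family UcardZ -> optimal (infinite_sem zero_jump) u ->
  reduces (fun n => [set p | card_Z (UcardZ p) (Posz n)])
          (fun n => [set p | infinite_sem zero_jump u p n]).
Proof.
move=> /card_Z_limit [c hc] hu; have [v hv] := write_result zero_jump c.
apply: reduces_trans _ (optimal_reduces v hu).
exists 0 => n p /= /hc h; exists p; last by rewrite addn0.
exact: hv.
Qed.

(* The two domains are the sums of the increments and of the decrements of the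
   approximations to the output. *)
Lemma halting_reduces_card_Z UcardZ u :
  strongly_universal (@PR2_family nat nat _ _) UcardZ ->
  reduces (fun n => [set p | halting_sem zero_jump u p n])
          (fun n => [set p | card_Z (UcardZ p) (Posz n)]).
Proof.
move=> hZ.
pose b (p : word) s :=
  if output_at (jump_at s) u (@code word type0_word p) s is Some y then y else 0.
pose up (p : word) s := sumn [seq b p i.+1 - b p i | i <- iota 0 s].
pose down (p : word) s := sumn [seq b p i - b p i.+1 | i <- iota 0 s].
have hb O : computable O (fun z : word * nat => b z.1 z.2).
  by have hj := comp_jump_at O; rewrite /b; comp.
apply: reduces_trans _ (universal_reduces (fun fg n => card_Z fg (Posz n)) hZ
  (V := fun p => (below_stages up p, below_stages down p)) _); last first.
  have h := hb no_oracle.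
  by split; apply: PR_family_below_stages; rewrite /up /down; comp.
exists 0 => n p /phi_relP /output_jump_at_limit [s0 hs0].
exists p; last by rewrite addn0.
have stage f s : sumn [seq f i | i <- iota 0 s.+1] =
    sumn [seq f i | i <- iota 0 s] + f s :> nat.
  by rewrite -addn1 iotaD map_cat sumn_cat /= addn0.
(* Truncated subtraction separates the rises of [b p] from its falls, and the sum telescopes. It
   starts from [0], since no program has halted at time [0]. *)
have updown s : up p s = down p s + b p s.
  elim: s => [|s]; first by rewrite /b.
  by rewrite /up /down !stage -/(up p s) -/(down p s); lia.
have bE s : s0 <= s -> b p s = n by rewrite /b => /hs0 ->.
have const f s : (forall i, s0 <= i -> f i = 0) -> s0 <= s ->
    sumn [seq f i | i <- iota 0 s] = sumn [seq f i | i <- iota 0 s0].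
  move=> hf /subnK <-; elim: (s - s0) => [|i IH] //.
  by rewrite addSn stage IH hf ?addn0 // leq_addl.
have mono f s s' : s <= s' ->
    sumn [seq f i | i <- iota 0 s] <= sumn [seq f i | i <- iota 0 s'].
  move=> /subnK <-; elim: (s' - s) => [|i IH] //.
  by rewrite addSn stage; apply: leq_trans IH (leq_addr _ _).
(* Increments and decrements vanish from stage [s0] on, so both partial sums reach their maximum
   there. *)
have lim f : (forall i, s0 <= i -> f i = 0) ->
    (forall s, sumn [seq f i | i <- iota 0 s] <= sumn [seq f i | i <- iota 0 s0]) /\
    eventually (fun s => sumn [seq f i | i <- iota 0 s] =
                         sumn [seq f i | i <- iota 0 s0]).
  move=> hf; split; last by exists s0 => s; apply: const.
  move=> s; rewrite -(const f (maxn s s0)) ?leq_maxr //.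
  by apply: mono; rewrite leq_maxl.
exists (up p s0), (down p s0); split.
- have [|h1 h2] := lim (fun i => b p i.+1 - b p i).
    by move=> i le; rewrite !bE ?subnn // leqW.
  exact: card_below_stages.
- have [|h1 h2] := lim (fun i => b p i - b p i.+1).
    by move=> i le; rewrite !bE ?subnn // leqW.
  exact: card_below_stages.
- by rewrite updown bE //; lia.
Qed.

(** * The Church representation *)

(** Unfolding the sequence and performing the assignment takes two steps, after which the runs
    coincide. This serves to build data into a program, as in the s-m-n theorem. *)
Lemma phi_assign_seq {X Y Z} {tX : type0 X} {tY : type0 Y} {tZ : type0 Z} O e c
    (x : X) (z : Z) (y : Y) : eval e (code x) = code z ->
  phi_rel O (Seq (Assign e) c) x y <-> phi_rel O c z y.
Proof.
move=> he.
have shift2 t : run O (Seq (Assign e) c) (code x) t.+2 = run O c (code z) t.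
  by rewrite /run !iterSr /= he.
split; last first.
  by move=> [t [h1 h2]]; exists t.+2; rewrite /outputs_in /halts_in shift2.
by move=> [[|[|t]] [//]]; rewrite /halts_in shift2 => h1 h2; exists t.
Qed.

Definition iterate_at (e : prog) (n x s : nat) : option nat :=
  iter n (fun o => if o is Some y then output_at no_oracle e (code y) s else None)
    (Some x).

Lemma iterate_at_sound e n x s y : iterate_at e n x s = Some y ->
  iterate n (phi e) x y.
Proof.
elim: n y => [|n IH] y; first by case.
rewrite /iterate_at iterS -/(iterate_at e n x s).
case E: (iterate_at e n x s) => [z|] // h; exists z; first exact: IH.
by apply/phi_relP; exists s.
Qed.

Lemma iterate_at_complete e n x y : iterate n (phi e) x y ->
  eventually (fun s => iterate_at e n x s = Some y).
Proof.
elim: n y => [|n IH] y; first by move=> ->; exists 0.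
move=> [z /IH hz /phi_relP [t ht]].
apply: eventually_mono (eventually_and hz (eventually_ge t)) => s [h le].
rewrite /iterate_at iterS -/(iterate_at e n x s) h.
exact: output_at_mono ht le.
Qed.

Lemma iterate_functional (f : pfun nat nat) n x y y' :
  (forall z u v, f z u -> f z v -> u = v) ->
  iterate n f x y -> iterate n f x y' -> y = y'.
Proof.
move=> hf; elim: n y y' => [|n IH] y y'; first by move=> /= <- <-.
by move=> [z hz fy] [z' hz' fy']; rewrite (IH _ _ hz' hz) in fy'; apply: hf fy fy'.
Qed.

Definition church_family (u : prog) : word -> operation nat nat :=
  fun p e x y => exists2 n, phi_rel no_oracle u p n & iterate n (phi e) x y.

Lemma church_family_It u p n : phi_rel no_oracle u p n ->
  church_family u p = It (Posz n).
Proof.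
move=> hn; apply/funext => e; apply/funext => x; apply/funext => y; apply/propext.
split; last by exists n.
by move=> [m hm h]; rewrite (phi_rel_functional hn hm).
Qed.

Lemma partial_recursive_church u : partial_recursive
  (fun (z : prog * (word * nat)) y => church_family u z.2.1 z.1 z.2.2 y).
Proof.
pose g (z : prog * (word * nat)) s :=
  if output_at no_oracle u (@code word type0_word z.2.1) s is Some n
  then iterate_at z.1 n z.2.2 s else None.
apply: (pr_search (g := g)).
- by rewrite /g /iterate_at; comp.
- move=> [e [p x]] s y; rewrite /g /=; case E: output_at => [n|] // h.
  exists n; first by apply/phi_relP; exists s.
  exact: iterate_at_sound h.
- move=> [e [p x]] y [n /phi_relP [t /= ht] /iterate_at_complete [s0 h]].
  exists (maxn s0 t); rewrite /g /= (output_at_mono ht) ?leq_maxr //.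
  by rewrite h ?leq_maxl.
- move=> [e [p x]] y y' [n hn h] [m hm h'].
  rewrite (phi_rel_functional hm hn) in h'.
  apply: iterate_functional h h' => z v w; exact: phi_rel_functional.
Qed.

(** The family depends on [e] only through [phi e], which gives extensionality. The index map builds
    the code of [e] into a program for the uncurried family. *)
Lemma Eff_family_church ext u :
  @Eff_family ext nat nat nat nat _ _ _ _ (church_family u).
Proof.
split; last first.
  move=> _ e e' he; apply/funext => pz; apply/funext => y.
  by rewrite /church_family he.
have [c hc] := partial_recursive_church u.
pose F (e : prog) := Seq (Assign (ECons (quote (@code prog type0_prog e)) Var)) c.
exists (fun e e' => e' = F e).
  apply: pr_total; apply: (@comp_via _ _ _ _ _ (fun e => Cons (code_nat 1)
    (Cons (Cons (code_nat 0) (Cons (code_nat 2)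
      (Cons (@code expr type0_expr (quote (code e))) (code Var)))) (code c)))) => //.
  have h : computable no_oracle (fun e : prog => quote (code e)).
    exact: comp_quote (comp_code (comp_id _)).
  by comp.
move=> e; exists (F e) => //.
apply/funext => -[p x]; apply/funext => y; apply/propext.
have := congr1 (fun f => f (e, (p, x)) y) hc => /= ->.
apply: iff_sym; apply: phi_assign_seq => /=.
by rewrite eval_quote.
Qed.

(** Both values of [ext] are treated at once, since [Church_N] and [Church_Z] agree on natural
    numbers. *)
Lemma halting_reduces_Church ext u U :
  strongly_universal (@Eff_family ext nat nat nat nat _ _ _ _) U ->
  reduces (fun n => [set p | halting_sem no_oracle u p n])
          (fun n => [set p | U p = It (Posz n)]).
Proof.
move=> hU.
apply: reduces_trans _ (universal_reduces (fun F n => F = It (Posz n)) hU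
  (Eff_family_church ext u)).
by exists 0 => n p /church_family_It h; exists p => //; rewrite addn0.
Qed.

(* The [n]-th iterate of the successor maps [0] to [n]. *)
Lemma Church_reduces_halting ext u U :
  @Eff_family ext nat nat nat nat _ _ _ _ U -> optimal (halting_sem no_oracle) u ->
  reduces (fun n => [set p | U p = It (Posz n)])
          (fun n => [set p | halting_sem no_oracle u p n]).
Proof.
move=> [[f _ hf] _] hu.
have [e he] : computable no_oracle (fun n : nat => n.+1) by comp.
have [e' _ hU] := hf e.
(* The assignment turns the word [p] into the pair [(p, 0)], as [0] is coded by [Nil]. *)
apply: reduces_trans _ (optimal_reduces (Seq (Assign (ECons Var ENil)) e') hu).
exists 0 => n p /= hp; exists p; last by rewrite addn0.
apply/(@phi_assign_seq _ _ _ _ _ _ _ _ _ _ (p, 0)) => //.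
have := congr1 (fun g => g (p, 0) n) hU; rewrite /= hp /phi => <-.
elim: n {hp} => //= n IH; exists n => //.
by have [t ht] := computes_run (he n); exists t; rewrite /outputs_in /halts_in ht.
Qed.

(** * Gaps *)

Lemma leq_sumn_map (T : eqType) (f g : T -> nat) (l : seq T) :
  (forall x, x \in l -> f x <= g x) -> sumn (map f l) <= sumn (map g l).
Proof.
elim: l => //= x l IH h; apply: leq_add; first by apply: h; rewrite mem_head.
by apply: IH => y hy; apply: h; rewrite inE hy orbT.
Qed.

Lemma sumn_map_ge (T : eqType) (f : T -> nat) (l : seq T) x :
  x \in l -> f x <= sumn (map f l).
Proof.
elim: l => //= y l IH; rewrite inE => /predU1P [->|/IH h]; first exact: leq_addr.
exact: leq_trans h (leq_addl _ _).
Qed.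

(** The successor makes the bound exceed the output; a program without output contributes [0]. *)
Definition output_bound O u (p : word) : nat :=
  xget 0 [set m | exists2 y, phi_rel O u p y & m = y.+1].

Lemma output_bound_limit O u (p : word) :
  let v s := if output_at O u (code p) s is Some y then y.+1 else 0 in
  (forall s, v s <= output_bound O u p) /\
  eventually (fun s => v s = output_bound O u p).
Proof.
rewrite /output_bound /=; case: xgetP => [m _ [y hy ->]|hN].
  have /phi_relP [t ht] := hy; split.
    by move=> s; case E: output_at => [z|] //; rewrite (output_at_unique E ht).
  by exists t => s le; rewrite (output_at_mono ht le).
have h s : output_at O u (code p) s = None.
  case E: output_at => [z|] //; case: (hN z.+1); exists z => //.
  by apply/phi_relP; exists s.
by split; [|exists 0]; move=> s *; rewrite h.
Qed.

(* A number exceeding all the outputs of programs of length at most [2 * j] can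
   be written from below by a program which only needs [j]. *)
Lemma infinite_halting_gap O u uinf :
  optimal (halting_sem O) u -> optimal (infinite_sem O) uinf ->
  exists c, forall j, exists n,
    complexity (infinite_sem O) uinf n <= j + c /\
    2 * j < complexity (halting_sem O) u n.
Proof.
move=> hu hinf.
pose v (p : word) s :=
  if output_at O u (@code word type0_word p) s is Some y then y.+1 else 0.
(* Only the length [j] of the input matters; it is doubled to range over the words of length at most
   [2 * j]. *)
pose a (w : word) s := sumn [seq v p s | p <- words (size w + size w)].
have ha : computable O (fun z : word * nat => a z.1 z.2).
  by rewrite /a /v; comp.
have [c hc] := write_up_to ha.
have [d hd] := hinf c; exists d => j.
pose ws : seq (seq bool) := words (j + j).
pose n := sumn [seq output_bound O u p | p <- ws].
exists n; split.
  have [|q hq le] := hd (nseq j true) n.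
    apply: hc => [s|]; rewrite /a size_nseq.
      by apply: (leq_sumn_map (l := ws)) => p _; apply: (output_bound_limit O u p).1.
    have : eventually (fun s => forall p, p \in ws -> v p s = output_bound O u p).
      by apply: eventually_all => p _; apply: (output_bound_limit O u p).2.
    apply: eventually_mono => s hs; congr sumn.
    exact/eq_in_map.
  by rewrite size_nseq in le; apply: leq_trans (min_length_le hq) le.
(* A program of length at most [2 * j] with output [n] would contribute [n.+1] to a sum equal to
   [n]. *)
rewrite /complexity; have [p hp <-] := min_length_attained (halting_nonempty hu n).
rewrite ltnNge; apply/negP => le.
have : output_bound O u p <= n.
  by apply: sumn_map_ge; apply: mem_words; lia.
have /phi_relP [t ht] := hp; have := (output_bound_limit O u p).1 t.
by rewrite ht; lia.
Qed.

(** The least number outside [l]. The iteration climbs until it leaves [l], and by the pigeonhole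
    principle it does so within the given number of rounds. *)
Definition mex (l : seq nat) : nat :=
  iter (size l).+1 (fun m => if m \in l then m.+1 else m) 0.

Lemma mexP l : mex l \notin l /\ forall m, m < mex l -> m \in l.
Proof.
pose f m := if m \in l then m.+1 else m.
have below k m : m < iter k f 0 -> m \in l.
  elim: k => //= k; rewrite {2}/f; case: ifP => // hk IH.
  by rewrite ltnS leq_eqVlt => /predU1P [->|/IH].
split; last exact: below.
apply/negP => hin.
(* If the final value were in [l], the iteration would never have stopped, and [l] would contain
   more distinct numbers than its size. *)
have full k : k <= (size l).+1 -> iter k f 0 = k.
  move=> le; have {}hin : iter (size l).+1 f 0 \in l by [].
  have up i m : m \notin l -> iter i f m = m.
    by move=> hm; elim: i => //= i ->; rewrite /f (negbTE hm).
  elim: k le => //= k IH lt; rewrite IH ?(ltnW lt) // /f.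
  case: ifP => // /negbT hk; case/negP: (hk).
  have e : iter (size l).+1 f 0 = k.
    rewrite -(subnK (ltnW lt)) iterD IH ?(ltnW lt) //; exact: up.
  by rewrite e in hin.
have := uniq_leq_size (iota_uniq 0 (size l).+1) (s2 := l).
rewrite size_iota ltnn => h; suff : false by [].
apply: h => m; rewrite mem_iota /= add0n => lt.
by apply: (below (size l).+1); rewrite full.
Qed.

Lemma mex_unique l m : m \notin l -> (forall i, i < m -> i \in l) -> mex l = m.
Proof.
move=> hm hlt; have [h1 h2] := mexP l.
apply/eqP; rewrite eqn_leq; apply/andP; split; rewrite leqNgt; apply/negP.
  by move=> /h2; apply/negP.
by move=> /hlt; apply/negP.
Qed.

Lemma comp_mex O {A} {tA : type0 A} (l : A -> seq nat) :
  computable O l -> computable O (fun a => mex (l a)).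
Proof. by move=> hl; rewrite /mex; comp. Qed.

(** The count is nondecreasing: it is bounded and stabilizes at its maximum, or it tends to
    infinity. *)
Lemma written_limit O c d : (exists n, eventually (fun t => written (run O c d t) = n))
  \/ forall m, eventually (fun t => m < written (run O c d t)).
Proof.
case: (pselect (exists m, forall t, written (run O c d t) <= m)) => [[m hm]|hN].
  left; pose P i := `[< exists t, written (run O c d t) = i >].
  have ex : exists i, P i by exists (written (run O c d 0)); apply/asboolP; exists 0.
  have bd i : P i -> i <= m by move=> /asboolP [t <-].
  case: (ex_maxnP ex bd) => n /asboolP [t ht] hmax; exists n; exists t => t' le.
  apply/eqP; rewrite eqn_leq hmax /=; last by apply/asboolP; exists t'.
  by rewrite -ht written_mono.
right=> m; case: (pselect (exists t, m < written (run O c d t))) => [[t ht]|hm].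
  by exists t => t' le; apply: leq_trans ht (written_mono _ _ _ le).
case: hN; exists m => t; rewrite leqNgt; apply/negP => h; case: hm; by exists t.
Qed.

(* The least number which is not written by any program of length at most
   [2 * j] is the limit of the least numbers not written at stage [s]. *)
Lemma halting_infinite_gap u uinf :
  optimal (halting_sem zero_jump) u -> optimal (infinite_sem no_oracle) uinf ->
  exists c, forall j, exists n,
    complexity (halting_sem zero_jump) u n <= j + c /\
    2 * j < complexity (infinite_sem no_oracle) uinf n.
Proof.
move=> hu hinf.
pose v (p : word) s := written (run no_oracle uinf (@code word type0_word p) s).
pose b (w : word) s := mex [seq v p s | p <- words (size w + size w)].
have hb O : computable O (fun z : word * nat => b z.1 z.2).
  by rewrite /b /v; apply: comp_mex; comp.
have [c hc] := limit_lemma hb; have [d hd] := hu c; exists d => j.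
pose ws : seq (seq bool) := words (j + j).
pose lim p := xget 0 [set n | eventually (fun s => v p s = n)].
pose conv p := `[< exists n, eventually (fun s => v p s = n) >].
pose l := [seq lim p | p <- ws & conv p].
have hlim p : conv p -> eventually (fun s => v p s = lim p).
  by move=> /asboolP h; rewrite /lim; apply: xgetPex h.
exists (mex l); have [h1 h2] := mexP l; split.
  have [|q hq le] := hd (nseq j true) (mex l).
    apply: computes_halting_sem; apply: hc; rewrite /b size_nseq.
    (* Convergent programs have reached their limits, and the others have already written more than
       [mex l] symbols, so they no longer affect the least missing number. *)
    have : eventually (fun s => forall p, p \in ws ->
        if conv p then v p s = lim p else mex l < v p s).
      apply: eventually_all => p _; case E: (conv p); first exact: hlim.
      have hN : ~ exists n, eventually (fun s => v p s = n) by move/asboolP; rewrite -/(conv p) E.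
      by case: (written_limit no_oracle uinf (@code word type0_word p)).
    apply: eventually_mono => s hs; apply: mex_unique.
      apply/negP => /mapP [p hp e]; have := hs p hp.
      case: ifPn => [hcv e'|_]; last by rewrite e ltnn.
      move/negP: h1; apply; rewrite e e'; apply/mapP; exists p => //.
      by rewrite mem_filter hcv.
    move=> i /h2 /mapP [p]; rewrite mem_filter => /andP [hcv hp] ->.
    by have := hs p hp; rewrite hcv => <-; apply/(mapP (s := ws)); exists p.
  by rewrite size_nseq in le; apply: leq_trans (min_length_le hq) le.
rewrite /complexity; have [p hp <-] := min_length_attained (infinite_nonempty hinf (mex l)).
rewrite ltnNge; apply/negP => le; move/negP: h1; apply.
have hcv : conv p by apply/asboolP; exists (mex l).
rewrite {1}(eventually_unique hp (hlim p hcv)); apply: map_f.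
by rewrite mem_filter hcv; apply: mem_words; lia.
Qed.

(** * The ordinal representation *)

Section Quotients.
Variable R : nat -> nat -> Prop.

Let equiv x y := preorder_of R x y /\ preorder_of R y x.

Lemma clos_trans_field x y : clos_trans nat R x y -> field_of R x /\ field_of R y.
Proof.
elim=> {x y} [x y h|x y z _ [hx _] _ [_ hz]] //.
by split; [exists y; left|exists x; right].
Qed.

Lemma preorder_of_trans x y z :
  preorder_of R x y -> preorder_of R y z -> preorder_of R x z.
Proof.
move=> [hx _ hxy] [_ hz hyz]; split=> //.
case: hxy hyz => [->|h] // [<-|h']; first by right.
by right; apply: t_trans h h'.
Qed.

Lemma equiv_class_eq x y : equiv x y ->
  [set z | equiv x z] = [set z | equiv y z].
Proof.
move=> [xy yx]; apply/seteqP; split=> z [h1 h2].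
  by split; [apply: preorder_of_trans yx h1|apply: preorder_of_trans h2 xy].
by split; [apply: preorder_of_trans xy h1|apply: preorder_of_trans h2 yx].
Qed.

Lemma equiv_refl x : field_of R x -> equiv x x.
Proof. by move=> h; split; split=> //; left. Qed.

Lemma equiv_of_class_eq x y : field_of R y ->
  [set z | equiv x z] = [set z | equiv y z] -> equiv x y.
Proof.
by move=> fy e; have := equiv_refl fy; rewrite -/([set z | equiv y z] y) -e.
Qed.

(** By the first condition [g] is a complete invariant of the classes; it is read off a chosen
    element of each class. *)
Lemma card_quotient_invariant (g : nat -> nat) n :
  (forall x y, field_of R x -> field_of R y -> equiv x y <-> g x = g y) ->
  (forall x, field_of R x -> g x < n) ->
  (forall k, k < n -> exists2 x, field_of R x & g x = k) ->
  quotient_of R #= `I_n.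
Proof.
move=> hg lt surj; apply/card_set_bijP.
have gE x : field_of R x -> g (xget 0 [set z | equiv x z]) = g x.
  move=> fx; have h : [set z | equiv x z] (xget 0 [set z | equiv x z]).
    by apply: xgetPex; exists x; apply: equiv_refl.
  by apply/esym/hg => //; case: h => -[].
exists (fun c => g (xget 0 c)); split.
- by move=> _ [x fx <-] /=; rewrite gE //; apply: lt.
- move=> _ _ /set_mem [x fx <-] /set_mem [y fy <-]; rewrite !gE // => e.
  by apply: equiv_class_eq; apply/hg.
- move=> k /surj [x fx <-]; exists [set z | equiv x z]; last exact: gE.
  by exists x.
Qed.

Definition representative (x : nat) : Prop :=
  field_of R x /\
  forall y, y < x -> ~ (clos_trans nat R x y /\ clos_trans nat R y x).

Lemma card_representatives n :
  quotient_of R #= `I_n -> [set x | representative x] #= `I_n.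
Proof.
apply: card_eq_trans; apply/card_set_bijP.
exists (fun x => [set z | equiv x z]); split.
- by move=> x [fx _]; exists x.
- have no x y : representative y -> equiv x y -> ~ x < y.
    move=> [_ hy] [[fx fy hxy] [_ _ hyx]] lt; apply: (hy x lt).
    by split; [case: hyx|case: hxy] => // e; move: lt; rewrite e ltnn.
  move=> x y /set_mem rx /set_mem ry e.
  have exy := equiv_of_class_eq ry.1 e.
  have eyx : equiv y x by case: exy.
  by case: (ltngtP x y) => // h; [case: (no x y ry exy h)|case: (no y x rx eyx h)].
- move=> _ [x fx <-].
  have ex : exists y, `[< equiv x y >] by exists x; apply/asboolP; apply: equiv_refl.
  case: (ex_minnP ex) => y /asboolP hxy hmin; exists y; last first.
    by apply/esym/equiv_class_eq.
  split; first by case: hxy => -[].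
  move=> z lt [yz zy]; have : y <= z; last by rewrite leqNgt lt.
  have [fy fz] := clos_trans_field yz.
  apply: hmin; apply/asboolP; case: hxy => h1 h2; split.
    by apply: preorder_of_trans h1 _; split=> //; right.
  by apply: preorder_of_trans _ h2; split=> //; right.
Qed.

End Quotients.

(** * Approximation of the classes of an enumerated relation *)

Section Paths.
Variable D : nat -> nat -> nat -> bool.
Hypothesis D_mono : forall x y s t, D x y s -> s <= t -> D x y t.

Let R x y := exists s, D x y s.

Definition path_step (x s : nat) (l : seq nat) : seq nat :=
  l ++ [seq y <- iota 0 s | has (fun z => D z y s) (x :: l)].

(** A finite approximation of the numbers reachable from [x]: [s] rounds of search through the edges
    seen by stage [s] and the numbers below [s]. *)
Definition paths (x s : nat) : seq nat := iter s (path_step x s) [::].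

Lemma paths_sound x y s : y \in paths x s -> clos_trans nat R x y.
Proof.
rewrite /paths; move: {1}s => k; elim: k y => [|k IH] y //=.
rewrite {1}/path_step mem_cat => /orP [/IH //|].
rewrite mem_filter => /andP [/= /orP [h|/hasP [z /IH hz h]] _].
  by apply: t_step; exists s.
by apply: t_trans hz _; apply: t_step; exists s.
Qed.

Lemma paths_complete x y : clos_trans nat R x y ->
  eventually (fun s => y \in paths x s).
Proof.
move=> hxy; have {hxy} h := clos_trans_tn1 _ _ _ _ hxy.
(* The number of rounds is first fixed to the length of a path; further rounds only append
   elements. *)
suff [k hk] : exists k, eventually (fun s => y \in iter k (path_step x s) [::]).
  apply: eventually_mono (eventually_and hk (eventually_ge k)) => s [hy le].
  have -> : paths x s = iter (s - k) (path_step x s) (iter k (path_step x s) [::]).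
    by rewrite -iterD subnK.
  by elim: (s - k) => // i IH; rewrite iterS mem_cat IH.
elim: h => {y} [y [t ht]|y z [t ht] _ [k hk]].
  exists 1; exists (maxn t y.+1) => s; rewrite geq_max => /andP [le lt].
  by rewrite /= mem_filter /= (D_mono ht le) mem_iota.
exists k.+1; apply: eventually_mono (eventually_and hk (eventually_ge (maxn t z.+1))).
move=> s [hy]; rewrite geq_max => /andP [le lt].
rewrite iterS mem_cat mem_filter mem_iota lt /= andbT; apply/orP; right.
by apply/orP; right; apply/hasP; exists y => //; apply: D_mono ht le.
Qed.

Definition representative_at (x s : nat) : bool :=
  has (fun y => D x y s || D y x s) (iota 0 s) &&
  ~~ has (fun y => (y \in paths x s) && (x \in paths y s)) (iota 0 x).

(** Membership in the field and equivalence with a smaller number are recursively enumerable: each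
    is seen from some stage on if it holds, and never otherwise. *)
Lemma representative_at_limit x :
  eventually (fun s => representative_at x s = `[< representative R x >]).
Proof.
have hfield : field_of R x -> eventually (fun s =>
    has (fun y => D x y s || D y x s) (iota 0 s)).
  move=> [y hy]; have [t ht] : exists t, D x y t || D y x t.
    by case: hy => -[t ht]; exists t; rewrite ht ?orbT.
  exists (maxn t y.+1) => s; rewrite geq_max => /andP [le lt].
  apply/hasP; exists y; first by rewrite mem_iota.
  by case/orP: ht => /D_mono ->; rewrite ?orbT.
have field_at s : has (fun y => D x y s || D y x s) (iota 0 s) -> field_of R x.
  by move=> /hasP [y _ /orP [h|h]]; exists y; [left|right]; exists s.
case: asboolP => [[fx hx]|hN].
  apply: eventually_mono (hfield fx) => s h; rewrite /representative_at h /=.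
  apply/hasPn => y; rewrite mem_iota /= add0n => /hx hy.
  by apply/negP => /andP [/paths_sound h1 /paths_sound h2]; apply: hy.
case: (pselect (field_of R x)) => fx; last first.
  exists 0 => s _; apply/negP => /andP [/field_at /fx []].
have [y [lt [h1 h2]]] : exists y, y < x /\
    (clos_trans nat R x y /\ clos_trans nat R y x).
  apply: contrapT => hne; apply: hN; split=> // y lt h; apply: hne; by exists y.
apply: eventually_mono (eventually_and (paths_complete h1) (paths_complete h2)).
move=> s [m1 m2]; apply/negP => /andP [_ /hasPn /(_ y)].
by rewrite mem_iota /= lt m1 m2 => /(_ isT).
Qed.

End Paths.

Lemma ord_reduces_infinite Uord u :
  PR_family Uord -> optimal (infinite_sem zero_jump) u ->
  reduces (fun n => [set p | ord_rep (Uord p) n])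
          (fun n => [set p | infinite_sem zero_jump u p n]).
Proof.
move=> /PR_family_prog [c hc] hu.
pose D (p : word) x y s :=
  isSome (output_at no_oracle c 
    (@code _ (type0_prod type0_word (type0_prod type0_nat type0_nat)) (p, (x, y))) s).
have D_mono p x y s t : D p x y s -> s <= t -> D p x y t.
  by rewrite /D; case E: output_at => [v|] // _ /(output_at_mono E) ->.
have DE p : (fun x y => dom (Uord p) (x, y)) = (fun x y => exists s, D p x y s).
  apply/funext => x; apply/funext => y; apply/propext; split.
    by move=> [v /hc /phi_relP [t ht]]; exists t; rewrite /D ht.
  move=> [s]; rewrite /D; case E: output_at => [v|] // _.
  by exists v; apply/hc; apply/phi_relP; exists s.
(* The indicator of least elements of classes is a limit of recursive functions, hence computable
   with the oracle; counting these elements gives the stages to be written. *)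
pose l (z : word * nat) : nat :=
  if `[< representative (fun x y => exists s, D z.1 x y s) z.2 >] then 1 else 0.
have hl : computable zero_jump l.
  apply: (comp_limit (b := fun z s =>
      if representative_at (D z.1) z.2 s then 1 else 0)).
    move=> O; rewrite /representative_at /paths /path_step /D.
    by comp.
  move=> [p x]; rewrite /l /=.
  by apply: eventually_mono (representative_at_limit (@D_mono p) x) => s ->.
pose a (p : word) s := count_at (fun x => l (p, x) == 1) s.
have ha : computable zero_jump (fun z : word * nat => a z.1 z.2).
  by apply: (comp_count_at (P := fun z x => l (z.1, x) == 1)); comp.
have [v hv] := write_up_to ha.
apply: reduces_trans _ (optimal_reduces v hu).
exists 0 => n p; rewrite /ord_rep /= DE => /card_representatives hr.
exists p; last by rewrite addn0.
have lE x : (l (p, x) == 1) = `[< representative (fun x y => exists s, D p x y s) x >].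
  by rewrite /l /=; case: asboolP.
have [] := count_at_limit (P := fun s x => l (p, x) == 1) hr.
- by move=> s x; rewrite lE => /asboolP.
- by move=> x hx; exists 0 => s _; rewrite lE; apply/asboolP.
- exact: hv.
Qed.

(** * The Cantor enumeration of pairs *)

Definition cantor_next (z : nat * nat) : nat * nat :=
  if z.1 == 0 then (z.2.+1, 0) else (z.1.-1, z.2.+1).

(** The walk follows an antidiagonal, then jumps to the start of the next one. As an iteration it is
    computable by the rules above. *)
Definition cantor (x : nat) : nat * nat := iter x cantor_next (0, 0).

Lemma cantor_inj : injective cantor.
Proof.
(* The inverse is the Cantor pairing polynomial: a triangular number plus the position on the
   antidiagonal. *)
pose e (z : nat * nat) := 'C((z.1 + z.2).+1, 2) + z.2.
suff h : cancel cantor e by exact: can_inj h.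
elim=> // x IH; rewrite /cantor iterS -/(cantor x) -[in RHS]IH.
case: (cantor x) => [[|T] i]; rewrite /e /cantor_next /=.
  by rewrite !addn0 add0n binS bin1; lia.
by rewrite addnS addSn addnS.
Qed.

Lemma cantor_surj T i : exists x, cantor x = (T, i).
Proof.
(* Induction on the antidiagonal, then on the position along it; its start is reached from the end
   [(0, m)] of the previous antidiagonal. *)
move: {2}(T + i) (erefl (T + i)) => m; elim: m T i => [|m IHm] T i.
  by case: T i => [|T] [|i] // _; exists 0.
elim: i T => [|i IHi] T hm.
  have [x hx] := IHm 0 m erefl; exists x.+1.
  by rewrite /cantor iterS -/(cantor x) hx /cantor_next /=; congr pair; lia.
have [|x hx] := IHi T.+1; first by rewrite addSnnS.
by exists x.+1; rewrite /cantor iterS -/(cantor x) hx.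
Qed.

Lemma written_step_le O s : written (step O s) <= (written s).+1.
Proof. by case: s => [[|[e|a b|e a||e] k] d w] //=; case: (eval e d). Qed.

(* A number coding [(T, i)] stands for the claim that the [T]-th step of the
   infinite computation writes a symbol, which is not the first one, and that
   [i] is the first stage from which this is never refuted. The numbers whose
   claim is false are merged into a single class, which accounts for the first
   symbol. *)
Section Claims.
Variable u : prog.

Definition writes_at (p : word) (T s : nat) : bool :=
  let W t := written (run (jump_at s) u (code p) t) in (W T < W T.+1) && (0 < W T).

Definition refuted (p : word) (x st : nat) : bool :=
  let T := (cantor x).1 in let i := (cantor x).2 in
  ~~ (writes_at p T i && ((i == 0) || ~~ writes_at p T i.-1)) ||
  has (fun s => (i <= s) && ~~ writes_at p T s) (iota 0 st).

(** The diagonal puts every number into the field, so that each true claim forms a class by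
    itself. *)
Definition merge (p : word) : pfun (nat * nat) nat :=
  fun xy z => z = 0 /\
    exists st, (xy.1 == xy.2) || refuted p xy.1 st && refuted p xy.2 st.

Lemma PR_family_merge : PR_family merge.
Proof.
apply: (pr_semidecidable (P := fun px st =>
  (px.2.1 == px.2.2) || refuted px.1 px.2.1 st && refuted px.1 px.2.2 st)).
have hj := comp_jump_at no_oracle.
have hw : computable no_oracle (fun z : word * nat * nat =>
    writes_at z.1.1 z.1.2 z.2).
  by rewrite /writes_at; comp.
have hc : computable no_oracle cantor by rewrite /cantor /cantor_next; comp.
have hr : computable no_oracle (fun z : word * nat * nat =>
    refuted z.1.1 z.1.2 z.2).
  by rewrite /refuted; comp.
by comp.
Qed.

Variables (p : word) (n : nat).
Hypotheses (n_gt0 : 0 < n) (hn : infinite_sem zero_jump u p n).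

Let W T := written (run zero_jump u (code p) T).
Let true_claim x := forall st, ~~ refuted p x st.
Let R x y := dom (merge p) (x, y).

Lemma claim_W_mono T T' : T <= T' -> W T <= W T'.
Proof. exact: written_mono. Qed.

Lemma claim_W_le T : W T <= n.
Proof.
have [t0 h] := hn; rewrite -(h (maxn T t0)) ?leq_maxr //.
by apply: claim_W_mono; rewrite leq_maxl.
Qed.

Lemma writes_at_limit T :
  eventually (fun s => writes_at p T s = (W T < W T.+1) && (0 < W T)).
Proof.
apply: eventually_mono (eventually_and (run_jump_at_limit u (code p) T)
  (run_jump_at_limit u (code p) T.+1)) => s [h1 h2].
by rewrite /writes_at h1 h2.
Qed.

Lemma refuted_mono x s t : refuted p x s -> s <= t -> refuted p x t.
Proof.
rewrite /refuted => /orP [->//|/hasP [i hi hr]] le; apply/orP; right.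
apply/hasP; exists i => //; move: hi; rewrite !mem_iota /= => hi.
exact: leq_trans hi le.
Qed.

Lemma mergeP x y : R x y <-> x = y \/ (~ true_claim x /\ ~ true_claim y).
Proof.
split.
  move=> [z [_ [st /= /orP [/eqP ->|/andP [hx hy]]]]]; first by left.
  by right; split=> /(_ st); [rewrite hx|rewrite hy].
have ex z : ~ true_claim z -> exists st, refuted p z st.
  move=> h; apply: contrapT => hN; apply: h => st; apply/negP => hst.
  by apply: hN; exists st.
move=> [->|[/ex [s hs] /ex [t ht]]]; exists 0; split=> //.
  by exists 0; rewrite eqxx.
exists (maxn s t) => /=; apply/orP; right; apply/andP; split.
  by apply: refuted_mono hs _; rewrite leq_maxl.
by apply: refuted_mono ht _; rewrite leq_maxr.
Qed.

Lemma true_claimP x : true_claim x <->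
  let T := (cantor x).1 in let i := (cantor x).2 in
  [/\ forall s, i <= s -> writes_at p T s & i = 0 \/ ~~ writes_at p T i.-1].
Proof.
split.
  move=> h; have := h 0; rewrite /refuted /= orbF negbK => /andP [h1 h2]; split.
    move=> s le; apply/negPn/negP => hs; have := h s.+1; rewrite /refuted.
    rewrite negb_or => /andP [_ /hasPn /(_ s)].
    by rewrite mem_iota /= ltnS leqnn le hs => /(_ isT).
  by case/orP: h2 => [/eqP ->|]; [left|right].
move=> /= [h1 h2] st; rewrite /refuted negb_or negbK h1 //=; apply/andP; split.
  by case: h2 => [->|->]; rewrite ?orbT.
by apply/hasPn => s _; rewrite negb_and negbK; case: leqP => // /h1 ->.
Qed.

Lemma true_claim_writes x : true_claim x ->
  W (cantor x).1 < W (cantor x).1.+1 /\ 0 < W (cantor x).1.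
Proof.
move=> /true_claimP /= [h _]; have [s0 hs0] := writes_at_limit (cantor x).1.
have := hs0 (maxn s0 (cantor x).2); rewrite leq_maxl h ?leq_maxr // => /(_ isT) e.
by apply/andP; rewrite -e.
Qed.

(** The count rises at the step of a true claim, so its value there determines the step; the
    minimality of the stage then determines the claim. *)
Lemma true_claim_unique x y : true_claim x -> true_claim y ->
  W (cantor x).1 = W (cantor y).1 -> x = y.
Proof.
move=> hx hy e; have [lx _] := true_claim_writes hx.
have [ly _] := true_claim_writes hy.
have eT : (cantor x).1 = (cantor y).1.
  case: (ltngtP (cantor x).1 (cantor y).1) => // /claim_W_mono; lia.
have first z z' : true_claim z -> true_claim z' ->
    (cantor z).1 = (cantor z').1 -> (cantor z).2 <= (cantor z').2.
  move=> /true_claimP /= [_ h] /true_claimP /= [h' _] ez; rewrite leqNgt.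
  apply/negP => lt; case: h => [h0|]; first by rewrite h0 in lt.
  by rewrite ez h' //; lia.
apply: cantor_inj; rewrite [LHS]surjective_pairing [RHS]surjective_pairing.
congr pair => //; apply/eqP; rewrite eqn_leq !first //.
Qed.

Lemma true_claim_exists T : W T < W T.+1 -> 0 < W T ->
  exists2 x, true_claim x & (cantor x).1 = T.
Proof.
move=> h1 h2; have [s0 hs0] := writes_at_limit T; rewrite h1 h2 in hs0.
have ex : exists i, `[< forall s, i <= s -> writes_at p T s >].
  by exists s0; apply/asboolP.
(* The least stage from which the approximations always accept the step gives the true claim. *)
case: (ex_minnP ex) => i /asboolP hi hmin; have [x hx] := cantor_surj T i.
exists x; last by rewrite hx.
apply/true_claimP; rewrite hx /=; split=> //.
case: i hi hmin {hx} => [|i] hi hmin; [by left|right; apply/negP => /= h].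
have : i < i; last by rewrite ltnn.
apply: hmin; apply/asboolP => s; rewrite leq_eqVlt => /predU1P [<-//|]; exact: hi.
Qed.

Lemma ord_rep_merge : ord_rep (merge p) n.
Proof.
have Rxx x : R x x by apply/mergeP; left.
have clos x y : clos_trans nat R x y -> R x y.
  elim=> {x y} // x y z _ /mergeP hxy _ /mergeP hyz; apply/mergeP.
  by case: hxy hyz => [->|[hx hy]] // [<-|[_ hz]]; right.
have fieldR x : field_of R x by exists x; left.
(* A true claim is sent to the number of symbols written before its step, which lies between [1] and
   [n - 1]; the class of the false claims takes the value [0]. *)
apply: (card_quotient_invariant (g := fun x =>
   if `[< true_claim x >] then W (cantor x).1 else 0)).
- move=> x y _ _; split.
    move=> [[_ _ h] _]; have {h}/mergeP : R x y by case: h => [->|/clos].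
    by move=> [->//|[hx hy]]; do 2 case: asboolP => //.
  move=> h; suff hR : R x y /\ R y x.
    by split; split=> //; right; apply: t_step; case: hR.
  move: h; case: asboolP => hx; case: asboolP => hy.
  + by move=> /(true_claim_unique hx hy) ->.
  + by have := true_claim_writes hx; lia.
  + by have := true_claim_writes hy; lia.
  + by move=> _; split; apply/mergeP; right.
- move=> x _; case: asboolP => // /true_claim_writes [lt _].
  exact: leq_trans lt (claim_W_le _).
- move=> k lt; case: (posnP k) => [->|k0].
    (* The number [0] codes the pair [(0, 0)], and nothing is written before step [0], so its value
       is [0] in either case. *)
    by exists 0 => //; case: asboolP.
  have ex : exists T, k < W T.+1.
    have [t0 h] := hn; exists t0; by rewrite {1}/W h // leqW.
  (* The first step after which more than [k] symbols are written starts with exactly [k], since a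
     step writes at most one symbol. *)
  case: (ex_minnP ex) => T hT hmin.
  have leT : W T <= k.
    case: T hT hmin => [|T] hT hmin; first by rewrite /W.
    by rewrite leqNgt; apply/negP => /hmin; rewrite ltnn.
  have st : W T.+1 <= (W T).+1 by apply: written_step_le.
  have [||x hx hxT] := @true_claim_exists T; [lia|lia|].
  exists x => //; case: asboolP => // _; rewrite hxT; lia.
Qed.

End Claims.

(** The value [n = 0] is left out, because the relation [merge] always has a nonempty field and
    hence at least one class. *)
Lemma infinite_reduces_ord Uord u :
  strongly_universal (@PR_family (nat * nat) nat _ _) Uord ->
  reduces (fun n => [set p | 0 < n /\ infinite_sem zero_jump u p n])
          (fun n => [set p | ord_rep (Uord p) n]).
Proof.
move=> hU; apply: reduces_trans _ (universal_reduces ord_rep hU (PR_family_merge u)).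
exists 0 => n p [n0 h]; exists p; last by rewrite addn0.
exact: ord_rep_merge h.
Qed.

Lemma ord_rep_0 Uord : strongly_universal (@PR_family (nat * nat) nat _ _) Uord ->
  [set p | ord_rep (Uord p) 0] !=set0.
Proof.
move=> hU.
have hE : @PR_family (nat * nat) nat _ _ (fun _ _ _ => False).
  by apply: (pr_search (g := fun _ _ => None)) => //; apply: comp_const.
have [c h] := universal_reduces ord_rep hU hE.
have [|q hq _] := h 0 [::]; last by exists q.
rewrite /ord_rep /= II0 card_eq0; apply/eqP/seteqP.
by split=> C // [x [y [[z []]|[z []]]]].
Qed.

(** * Assembling the comparisons *)

Theorem mainTheorem1
    (UChurchN : word -> operation nat nat)
    (hChurchN : strongly_universal (@Eff_family true nat nat nat nat _ _ _ _)
                  UChurchN)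
    (ext : bool) (UChurchZ : word -> operation nat nat)
    (hChurchZ : strongly_universal (@Eff_family ext nat nat nat nat _ _ _ _)
                  UChurchZ)
    (UcardN : word -> pfun nat nat)
    (hcardN : strongly_universal (@PR_family nat nat _ _) UcardN)
    (UcardZ : word -> pfun nat nat * pfun nat nat)
    (hcardZ : strongly_universal (@PR2_family nat nat _ _) UcardZ)
    (Uord : word -> pfun (nat * nat) nat)
    (hord : strongly_universal (@PR_family (nat * nat) nat _ _) Uord)
    (u : prog) (hu : optimal (halting_sem no_oracle) u)
    (uinf : prog) (huinf : optimal (infinite_sem no_oracle) uinf)
    (u' : prog) (hu' : optimal (halting_sem zero_jump) u')
    (uinf' : prog) (huinf' : optimal (infinite_sem zero_jump) uinf') :
  let K := complexity (halting_sem no_oracle) u in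
  let Kinf := complexity (infinite_sem no_oracle) uinf in
  let K' := complexity (halting_sem zero_jump) u' in
  let Kinf' := complexity (infinite_sem zero_jump) uinf' in
  let KChurchN := K_rep Church_N UChurchN in
  let KChurchZ := fun n : nat => K_rep Church_Z UChurchZ (Posz n) in
  let KcardN := K_rep card_N UcardN in
  let KcardZ := fun n : nat => K_rep card_Z UcardZ (Posz n) in
  let Kord := K_rep ord_rep Uord in
  (eq_ct KChurchN KChurchZ /\ eq_ct KChurchZ K /\
   eq_ct KcardN Kinf /\
   eq_ct KcardZ K' /\
   eq_ct Kord Kinf') /\
  (eq_ct KChurchN KChurchZ /\ lt_ct KcardN KChurchZ /\
   lt_ct KcardZ KcardN /\ lt_ct Kord KcardZ).
Proof.
move=> K Kinf K' Kinf' KChurchN KChurchZ KcardN KcardZ Kord.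
have K_ne := halting_nonempty hu.
have Kinf_ne := infinite_nonempty huinf.
have K'_ne := halting_nonempty hu'.
have Kinf'_ne := infinite_nonempty huinf'.
have r_ChurchN := halting_reduces_Church u hChurchN.
have r_ChurchZ := halting_reduces_Church u hChurchZ.
have ChurchN_ne n := reduces_nonempty (K_ne n) r_ChurchN.
have ChurchZ_ne n := reduces_nonempty (K_ne n) r_ChurchZ.
have r_cardN := infinite_reduces_card_N uinf hcardN.
have cardN_ne n := reduces_nonempty (Kinf_ne n) r_cardN.
have r_cardZ := halting_reduces_card_Z u' hcardZ.
have cardZ_ne n := reduces_nonempty (K'_ne n) r_cardZ.
have r_ord := infinite_reduces_ord uinf' hord.
have ord_ne n : [set p | ord_rep (Uord p) n] !=set0.
  case: n => [|n]; first exact: ord_rep_0.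
  have [p hp] := Kinf'_ne n.+1.
  by apply: reduces_nonempty r_ord; exists p.
have ChurchN_le_K : le_ct KChurchN K := reduces_le_ct K_ne r_ChurchN.
have ChurchZ_le_K : le_ct KChurchZ K := reduces_le_ct K_ne r_ChurchZ.
have K_le_ChurchN : le_ct K KChurchN :=
  reduces_le_ct ChurchN_ne (Church_reduces_halting hChurchN.1 hu).
have K_le_ChurchZ : le_ct K KChurchZ :=
  reduces_le_ct ChurchZ_ne (Church_reduces_halting hChurchZ.1 hu).
have cardN_le_Kinf : le_ct KcardN Kinf := reduces_le_ct Kinf_ne r_cardN.
have Kinf_le_cardN : le_ct Kinf KcardN :=
  reduces_le_ct cardN_ne (card_N_reduces_infinite hcardN.1 huinf).
have cardZ_le_K' : le_ct KcardZ K' := reduces_le_ct K'_ne r_cardZ.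
have K'_le_cardZ : le_ct K' KcardZ :=
  reduces_le_ct cardZ_ne (card_Z_reduces_halting hcardZ.1 hu').
have Kinf'_le_cardZ : le_ct Kinf' KcardZ :=
  reduces_le_ct cardZ_ne (card_Z_reduces_infinite hcardZ.1 huinf').
have Kinf'_le_ord : le_ct Kinf' Kord :=
  reduces_le_ct ord_ne (ord_reduces_infinite hord.1 huinf').
have cardN_le_K : le_ct KcardN K :=
  reduces_le_ct K_ne (halting_reduces_card_N u hcardN).
have cardZ_le_cardN : le_ct KcardZ KcardN :=
  reduces_le_ct cardN_ne (card_N_reduces_card_Z hcardN.1 hcardZ).
have ord_le_Kinf' : le_ct Kord Kinf'.
  (* The constant is enlarged by [Kord 0] to cover the case [n = 0]. *)
  have [c hc] := r_ord; exists (c + Kord 0) => -[|n]; first by lia.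
  have [p hp sp] := min_length_attained (Kinf'_ne n.+1).
  have [q hq le] := hc n.+1 p (conj isT hp).
  rewrite /Kord /K_rep /Kinf' /complexity -sp addnA.
  exact: leq_trans (leq_trans (min_length_le hq) le) (leq_addr _ _).
have Church_eq : eq_ct KChurchN KChurchZ.
  by split; [apply: le_ct_trans ChurchN_le_K K_le_ChurchZ
            |apply: le_ct_trans ChurchZ_le_K K_le_ChurchN].
split; [split=> //; do ![split=> //]|split=> //; split; [|split]].
- apply: lt_ct_gap (le_ct_trans cardN_le_K K_le_ChurchZ) cardN_le_Kinf
    K_le_ChurchZ _.
  exact: infinite_halting_gap.
- apply: lt_ct_gap cardZ_le_cardN cardZ_le_K' Kinf_le_cardN _.
  exact: halting_infinite_gap.
(* The gap between halting and infinite computations holds for every oracle, here for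
   [zero_jump]. *)
- apply: lt_ct_gap (le_ct_trans ord_le_Kinf' Kinf'_le_cardZ) ord_le_Kinf'
    K'_le_cardZ _.
  exact: infinite_halting_gap.
Qed.
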